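(* Let $A$ be an $N$-interior $p$-permutation $G$-algebra, where $N\trianglelefteq G$, and let $c$ be a primitive idempotent of $A^N$ such that $c\in A^G$. Let $(Q,f_Q)$ be an $(A,c,G)$-Brauer pair such that $Q$ is a defect group of $c$ in $N$. Fix a maximal $(A,c,G)$-Brauer pair $(P,f_P)$ such that $(Q,f_Q)\leq (P,f_P)$, and assume that $f_Q$ is primitive in $A(Q)^{C_N(Q)}$. Put $H=N_G(Q,f_Q)$. Let $\mathcal{C}$ be the full subcategory of the fusion system $\mathcal{F}_{(P,f_P)}(A,c,G)$ whose objects are the pairs belonging to $F_1$, and let $\mathcal{D}$ be the full subcategory of the fusion system $\mathcal{F}_{(P,f_P)}(A(Q),f_Q,H)$ whose objects are the pairs belonging to $F_2$. Then the categories $\mathcal{D}$ and $\mathcal{C}$ are isomorphic.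
   Context: $k$ is a field of prime characteristic $p$ (not necessarily algebraically closed), algebras are finite dimensional over $k$, $G$ is a finite group and $N$ is a normal subgroup of $G$ with $p$ dividing $|N|$. A $G$-algebra $A$ is a $k$-algebra on which $G$ acts by algebra automorphisms; it is a $p$-permutation $G$-algebra if for every $p$-subgroup $P$ of $G$ it has a $P$-stable $k$-basis. It is $N$-interior if it is equipped with a $G$-equivariant unital algebra homomorphism $kN\to A$ such that the action of $n\in N$ on $A$ is conjugation by the image of $n$. For $K\le L\le G$: $A^L$ is the subalgebra of $L$-fixed elements, $\mathrm{Tr}_K^L(a)=\sum_{x\in[L/K]}{}^xa$ for $a\in A^K$, and $A_K^L=\mathrm{Tr}_K^L(A^K)$. For a $p$-subgroup $Q$ of $G$, $A(Q)=A^Q/\sum_{R<Q}A_R^Q$, with quotient map the Brauer homomorphism $\mathrm{Br}_Q^A:A^Q\to A(Q)$; $A(Q)$ is an $N_G(Q)$-algebra. For $Q\le S\le N_G(Q)$ one identifies $A(Q)(S)$ with $A(S)$ so that $\mathrm{Br}_S^{A(Q)}\circ \mathrm{Br}_Q^A=\mathrm{Br}_S^A$ on $A^S$. A block of an algebra is a primitive idempotent of its centre. $N_G(Q,f)$ denotes the stabilizer of $f\in A(Q)$ in $N_G(Q)$. The idempotent $c$ has defect group $Q$ in $N$ if $Q$ is a $p$-subgroup of $N$ with $c\in A_Q^N$ and $\mathrm{Br}_Q^A(c)\ne 0$. For a $p$-permutation $G$-algebra $A$ and a primitive idempotent $c$ of $A^G$, an $(A,c,G)$-Brauer pair is a pair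 $(R,e)$ with $R$ a $p$-subgroup of $G$ and $e$ a block of $A(R)$ such that $\mathrm{Br}_R^A(c)e\neq 0$. The order is: $(R,e)\le (S,f)$ if $R\le S$ and for every primitive idempotent $i$ of $A^S$ with $\mathrm{Br}_S^A(i)f\neq0$ one has $\mathrm{Br}_R^A(i)e\ne0$. $G$ acts on these pairs by conjugation: ${}^x(R,e)=({}^xR,{}^xe)$. The same definitions are applied to the triple $(A(Q),f_Q,H)$ in place of $(A,c,G)$ (using $A(Q)(R)=A(R)$ for $Q\le R\le H$). $F_1$ is the set of $(A,c,G)$-Brauer pairs $(R,f_R)$ such that $(Q,f_Q)\le(R,f_R)$ as $(A,c,G)$-Brauer pairs. $F_2$ is the set of $(A(Q),f_Q,H)$-Brauer pairs $(R,f_R)$ such that $(Q,f_Q)\le (R,f_R)$ as $(A(Q),f_Q,H)$-Brauer pairs. For a maximal $(A,c,G)$-Brauer pair $(U,f_U)$, the fusion system $\mathcal{F}_{(U,f_U)}(A,c,G)$ is the category whose objects are the $(A,c,G)$-Brauer pairs $(R,f_R)\le(U,f_U)$ and whose morphisms from $(S,f_S)$ to $(T,f_T)$ are the group homomorphisms $c_x:S\to T$, $c_x(u)=xux^{-1}$, for $x\in G$ with ${}^x(S,f_S)\le (T,f_T)$. The category $\mathcal{F}_{(U,f_U)}(A(Q),f_Q,H)$ is defined in the same way with $(A(Q),f_Q,H)$ in place of $(A,c,G)$. *)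

(* Defs.v *)
From HB Require Import structures.
From mathcomp Require Import all_boot all_order all_fingroup all_algebra pgroup.
From Stdlib Require Import Classical ProofIrrelevance.

Set Implicit Arguments.
Unset Strict Implicit.
Unset Printing Implicit Defensive.

Import GRing.Theory.
Local Open Scope ring_scope.

(* Finite dimensional associative unital algebras over a field.  Unlike       *)
(* MathComp's falgType, the zero algebra is allowed: A(Q) below can be zero.  *)
Record fdAlgebra (k : fieldType) := FdAlgebra {
  fd_vect : vectType k;
  fd_one : fd_vect;
  fd_mul : fd_vect -> fd_vect -> fd_vect;
  fd_mulA : associative fd_mul;
  fd_mul1l : left_id fd_one fd_mul;
  fd_mul1r : right_id fd_one fd_mul;
  fd_mulDl : left_distributive fd_mul +%R;
  fd_mulDr : right_distributive fd_mul +%R;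
  fd_scaleAl : forall a x y, a *: fd_mul x y = fd_mul (a *: x) y;
  fd_scaleAr : forall a x y, a *: fd_mul x y = fd_mul x (a *: y)
}.

Definition fd_sort (k : fieldType) (A : fdAlgebra k) : Type := fd_vect A.
Coercion fd_sort : fdAlgebra >-> Sortclass.

HB.instance Definition _ k (A : fdAlgebra k) :=
  Vector.copy (fd_sort A) (fd_vect A).
HB.instance Definition _ k (A : fdAlgebra k) :=
  GRing.Zmodule_isPzRing.Build (fd_sort A) (@fd_mulA k A) (@fd_mul1l k A)
    (@fd_mul1r k A) (@fd_mulDl k A) (@fd_mulDr k A).

Definition fd_vectType k (A : fdAlgebra k) : vectType k := fd_sort A.
Coercion fd_vectType : fdAlgebra >-> Vector.type.

Lemma fd_scalerAl k (A : fdAlgebra k) (a : k) (x y : A) :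
  a *: (x * y) = (a *: x) * y.
Proof. exact: fd_scaleAl. Qed.

Lemma fd_scalerAr k (A : fdAlgebra k) (a : k) (x y : A) :
  a *: (x * y) = x * (a *: y).
Proof. exact: fd_scaleAr. Qed.

(* e is a primitive idempotent of the subalgebra of A with carrier S *)
Definition primitive_idempotent (A : pzRingType) (S : A -> Prop) (e : A) :=
  [/\ S e, e * e = e, e != 0
    & forall i j, S i -> S j -> i * i = i -> j * j = j ->
        i * j = 0 -> j * i = 0 -> e = i + j -> i = 0 \/ j = 0].

Definition centre (A : pzRingType) (z : A) := forall a : A, z * a = a * z.

Definition block (A : pzRingType) (e : A) := primitive_idempotent (@centre A) e.

Section GroupAlgebra.
Variables (k : fieldType) (hT : finGroupType).

Local Notation kH := {ffun hT -> k^o}.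
Implicit Types f g h : kH.

Definition ga_one : kH := [ffun x => (x == 1%g)%:R].
Definition ga_mul f g : kH :=
  [ffun x => \sum_(y : hT) (f y : k) * g (y^-1 * x)%g].

Fact ga_mulA : associative ga_mul.
Proof.
move=> f g h; apply/ffunP=> x; rewrite !ffunE.
under eq_bigr => y _ do rewrite ffunE mulr_sumr.
under [RHS]eq_bigr => y _ do rewrite ffunE mulr_suml.
rewrite [RHS]exchange_big /=; apply: eq_bigr => y _.
rewrite [RHS](reindex_inj (mulgI y)) /=; apply: eq_bigr => z _.
by rewrite mulrA mulKg invMg mulgA.
Qed.

Fact ga_mul1 : left_id ga_one ga_mul.
Proof.
move=> f; apply/ffunP=> x; rewrite !ffunE (bigD1 1%g) //= ffunE eqxx mul1r.
rewrite invg1 mul1g big1 ?addr0 // => y /negPf ny.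
by rewrite ffunE ny mul0r.
Qed.

Fact ga_mulr1 : right_id ga_one ga_mul.
Proof.
move=> f; apply/ffunP=> x; rewrite !ffunE (bigD1 x) //= ffunE mulVg eqxx mulr1.
rewrite big1 ?addr0 // => y /negPf ny; rewrite ffunE.
by rewrite -eq_mulVg1 ny mulr0.
Qed.

Fact ga_mulDl : left_distributive ga_mul +%R.
Proof.
move=> f g h; apply/ffunP=> x; rewrite !ffunE -big_split /=.
by apply: eq_bigr => y _; rewrite ffunE mulrDl.
Qed.

Fact ga_mulDr : right_distributive ga_mul +%R.
Proof.
move=> f g h; apply/ffunP=> x; rewrite !ffunE -big_split /=.
by apply: eq_bigr => y _; rewrite ffunE mulrDr.
Qed.

Fact ga_scalerAl (a : k) f g : a *: ga_mul f g = ga_mul (a *: f) g.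
Proof.
apply/ffunP=> x; rewrite !ffunE /= /GRing.scale /= mulr_sumr.
by apply: eq_bigr => y _; rewrite ffunE mulrA.
Qed.

Fact ga_scalerAr (a : k) f g : a *: ga_mul f g = ga_mul f (a *: g).
Proof.
apply/ffunP=> x; rewrite !ffunE /= /GRing.scale /= mulr_sumr.
by apply: eq_bigr => y _; rewrite ffunE mulrCA.
Qed.

Definition group_algebra : fdAlgebra k :=
  FdAlgebra ga_mulA ga_mul1 ga_mulr1 ga_mulDl ga_mulDr ga_scalerAl ga_scalerAr.

Definition ga_elt (x : hT) : group_algebra := [ffun y => (y == x)%:R].

End GroupAlgebra.

(* A G-algebra.  The group acts on the left; galg_act x is only constrained   *)
(* (and only relevant) for x in G.                                            *)
Record galgebra (k : fieldType) (gT : finGroupType) (G : {group gT}) := GAlgebra {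
  galg_sort :> fdAlgebra k;
  galg_act : gT -> 'End(galg_sort);
  galg_act1 : forall a, galg_act 1%g a = a;
  galg_actM : forall x y, x \in G -> y \in G ->
    forall a, galg_act (x * y)%g a = galg_act x (galg_act y a);
  galg_act_mul : forall x, x \in G ->
    forall a b, galg_act x (a * b) = galg_act x a * galg_act x b;
  galg_act_one : forall x, x \in G -> galg_act x 1 = 1
}.

Section FixedTrace.
Variables (k : fieldType) (gT : finGroupType) (G : {group gT}).
Variable A : galgebra k G.
Implicit Types (L K R : {group gT}) (a b : A).

(* A^L *)
Definition gfix (L : {set gT}) : {vspace A} :=
  (\bigcap_(x in L) fixedSpace (galg_act A x))%VS.

(* Tr_K^L, as an endomorphism of A; meaningful on A^K only *)
Definition gtrace (K L : {set gT}) : 'End(A) :=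
  \sum_(X in lcosets K L) galg_act A (repr X).

(* A_K^L *)
Definition gtrace_img (K L : {set gT}) : {vspace A} :=
  (gtrace K L @: gfix K)%VS.

(* the kernel of the Brauer homomorphism on A^L *)
Definition gbrauer_ker (L : {set gT}) : {vspace A} :=
  (\sum_(R : {group gT} | R \proper L) gtrace_img R L)%VS.

Lemma gfixP (L : {set gT}) a :
  reflect (forall x, x \in L -> galg_act A x a = a) (a \in gfix L).
Proof.
rewrite memvE; apply: (iffP subv_bigcapP) => h x Lx.
  by apply/fixedSpaceP; rewrite memvE; apply: h.
by rewrite -memvE; apply/fixedSpaceP/h.
Qed.

Lemma gfixS (K L : {set gT}) : K \subset L -> (gfix L <= gfix K)%VS.
Proof.
move=> /subsetP sKL; apply/subvP => a /gfixP h.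
by apply/gfixP => x /sKL; apply: h.
Qed.

Lemma gtraceE (K L : {set gT}) a :
  gtrace K L a = \sum_(X in lcosets K L) galg_act A (repr X) a.
Proof. by rewrite /gtrace sum_lfunE. Qed.

Lemma galg_actK x a : x \in G -> galg_act A x^-1%g (galg_act A x a) = a.
Proof. by move=> Gx; rewrite -galg_actM ?groupV // mulVg galg_act1. Qed.

Lemma galg_actKV x a : x \in G -> galg_act A x (galg_act A x^-1%g a) = a.
Proof. by move=> Gx; rewrite -galg_actM ?groupV // mulgV galg_act1. Qed.

Section InG.
Variable L : {group gT}.
Hypothesis sLG : L \subset G.

Lemma gfix_mul a b : a \in gfix L -> b \in gfix L -> a * b \in gfix L.
Proof.
move=> /gfixP La /gfixP Lb; apply/gfixP => x Lx.
by rewrite galg_act_mul ?(subsetP sLG) // La // Lb.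
Qed.

Lemma gfix_one : 1 \in gfix L.
Proof. by apply/gfixP => x Lx; rewrite galg_act_one ?(subsetP sLG). Qed.

Lemma repr_lcoset K x a : K \subset L -> x \in L -> a \in gfix K ->
  galg_act A (repr (x *: K)%g) a = galg_act A x a.
Proof.
move=> sKL Lx /gfixP Ka.
have /lcosetP[y Ky ->] := mem_repr x (lcoset_refl K x).
have [Gx Gy] : x \in G /\ y \in G by rewrite !(subsetP sLG) // (subsetP sKL).
by rewrite galg_actM // Ka.
Qed.

Lemma lcosets_repr K X : K \subset L -> X \in lcosets K L ->
  repr X \in L /\ X = (repr X *: K)%g.
Proof.
move=> sKL /lcosetsP[x Lx ->].
have /lcosetP[y Ky e] := mem_repr x (lcoset_refl K x).
have Ly: y \in L by apply: (subsetP sKL).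
rewrite e; split; first exact: groupM.
by rewrite lcosetM (lcoset_id Ky).
Qed.

Lemma gtrace_fix K a : K \subset L -> a \in gfix K -> gtrace K L a \in gfix L.
Proof.
move=> sKL Ka; apply/gfixP => x Lx; rewrite gtraceE linear_sum /=.
pose h X := (x *: X)%g.
rewrite [RHS](reindex_inj (h := h)) /=; last exact: lcoset_inj.
apply: eq_big => [X | X LX].
  have imp z Y : z \in L -> Y \in lcosets K L -> (z *: Y)%g \in lcosets K L.
    move=> Lz /lcosetsP[y Ly ->].
    by rewrite -lcosetM; apply/lcosetsP; exists (z * y)%g => //; rewrite groupM.
  apply/idP/idP; first exact: imp.
  by move/(imp x^-1%g); rewrite groupV /h lcosetK; apply.
have [Lr defX] := lcosets_repr sKL LX.
rewrite /h {2}defX -lcosetM repr_lcoset ?groupM //.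
by rewrite galg_actM // (subsetP sLG).
Qed.

Lemma gtrace_mull K a b : K \subset L -> a \in gfix L -> 
  a * gtrace K L b = gtrace K L (a * b).
Proof.
move=> sKL /gfixP La; rewrite !gtraceE mulr_sumr; apply: eq_bigr => X LX.
have [Lr _] := lcosets_repr sKL LX.
by rewrite galg_act_mul ?(subsetP sLG) // La.
Qed.

Lemma gtrace_mulr K a b : K \subset L -> a \in gfix L -> 
  gtrace K L b * a = gtrace K L (b * a).
Proof.
move=> sKL /gfixP La; rewrite !gtraceE mulr_suml; apply: eq_bigr => X LX.
have [Lr _] := lcosets_repr sKL LX.
by rewrite galg_act_mul ?(subsetP sLG) // La.
Qed.

End InG.

Lemma gbrauer_kerP (L : {group gT}) a :
  reflect (exists2 b : {group gT} -> A,
             forall R, R \proper L -> b R \in gfix R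
           & a = \sum_(R : {group gT} | R \proper L) gtrace R L (b R))
          (a \in gbrauer_ker L).
Proof.
apply: (iffP memv_sumP) => [[v Lv ->] | [b Lb ->]].
  have /fin_all_exists[b Pb] (R : {group gT}) :
      exists b, R \proper L -> b \in gfix R /\ v R = gtrace R L b.
    have [LR | nLR] := boolP (R \proper L); last by exists 0.
    by have /memv_imgP[b Rb ->] := Lv R LR; exists b.
  exists b => [R /Pb[] // | ].
  by apply: eq_bigr => R /Pb[].
by exists (fun R => gtrace R L (b R)) => // R /Lb Rb; apply: memv_img.
Qed.

Lemma gbrauer_ker_fix (L : {group gT}) :
  L \subset G -> (gbrauer_ker L <= gfix L)%VS.
Proof.
move=> sLG; apply/subvP => _ /gbrauer_kerP[b Lb ->].
by apply: memv_suml => R LR; apply: gtrace_fix (Lb _ LR) => //; apply: proper_sub.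
Qed.

Lemma gbrauer_ker_mull (L : {group gT}) a b : L \subset G ->
  a \in gfix L -> b \in gbrauer_ker L -> a * b \in gbrauer_ker L.
Proof.
move=> sLG La /gbrauer_kerP[d Ld ->]; rewrite mulr_sumr.
apply/gbrauer_kerP; exists (fun R => a * d R) => [R LR | ].
  have sRL := proper_sub LR; have Ra := subvP (gfixS sRL) a La.
  by apply: gfix_mul; rewrite ?Ld // (subset_trans sRL).
by apply: eq_bigr => R LR; rewrite gtrace_mull // proper_sub.
Qed.

Lemma gbrauer_ker_mulr (L : {group gT}) a b : L \subset G ->
  a \in gfix L -> b \in gbrauer_ker L -> b * a \in gbrauer_ker L.
Proof.
move=> sLG La /gbrauer_kerP[d Ld ->]; rewrite mulr_suml.
apply/gbrauer_kerP; exists (fun R => d R * a) => [R LR | ].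
  have sRL := proper_sub LR; have Ra := subvP (gfixS sRL) a La.
  by apply: gfix_mul; rewrite ?Ld // (subset_trans sRL).
by apply: eq_bigr => R LR; rewrite gtrace_mulr // proper_sub.
Qed.

Lemma gfix_act (L : {group gT}) x a : L \subset G -> x \in G ->
  a \in gfix L -> galg_act A x a \in gfix (L :^ x^-1)%g.
Proof.
move=> sLG Gx /gfixP La; apply/gfixP => y; rewrite mem_conjgV => Ly.
have Gyx: (y ^ x)%g \in G by apply: (subsetP sLG).
have defy: (y * x = x * (y ^ x))%g by rewrite conjgE !mulgA mulgV mul1g.
have Gy: y \in G by rewrite -(groupJr _ Gx).
by rewrite -galg_actM // defy galg_actM // La.
Qed.

Lemma gtrace_act (K L : {group gT}) x a : K \subset L -> L \subset G ->
    x \in G -> a \in gfix K ->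
  galg_act A x (gtrace K L a)
    = gtrace (K :^ x^-1)%g (L :^ x^-1)%g (galg_act A x a).
Proof.
move=> sKL sLG Gx Ka; rewrite !gtraceE linear_sum /=.
pose h (X : {set gT}) := (X :^ x^-1)%g.
rewrite [RHS](reindex_inj (h := h)) /=; last exact: conjsg_inj.
have lcJ z (X : {set gT}) y : ((y *: X) :^ z = (y ^ z) *: (X :^ z))%g.
  by rewrite conjsMg conjg_set1.
apply: eq_big => [X | X LX].
  apply/idP/idP => [/lcosetsP[y Ly ->] | /lcosetsP[y Ly hX]].
    by rewrite /h lcJ; apply/lcosetsP; exists (y ^ x^-1)%g; rewrite ?memJ_conjg.
  apply/lcosetsP; exists (y ^ x)%g; first by rewrite -mem_conjgV.
  by rewrite -[X](conjsgKV x) -/(h X) hX lcJ conjsgKV.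
have [Lr defX] := lcosets_repr sKL LX.
rewrite /h {2}defX lcJ.
have sLxG: (L :^ x^-1 \subset G)%g by rewrite -(conjGid (groupVr Gx)) conjSg.
have Gr: repr X \in G by apply: (subsetP sLG).
rewrite (@repr_lcoset (L :^ x^-1)%G sLxG (K :^ x^-1)%G) ?conjSg ?memJ_conjg //.
  rewrite -!galg_actM ?groupJ ?groupV //.
  by rewrite conjgE invgK !mulgA mulgKV.
by rewrite gfix_act // (subset_trans sKL).
Qed.

Lemma gbrauer_ker_act (L : {group gT}) x a : L \subset G -> x \in G ->
  a \in gbrauer_ker L -> galg_act A x a \in gbrauer_ker (L :^ x^-1)%G.
Proof.
move=> sLG Gx /gbrauer_kerP[b Lb ->]; rewrite linear_sum /=.
apply: memv_suml => R LR; have sRL := proper_sub LR.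
rewrite gtrace_act ?Lb //.
apply: (subvP (sumv_sup (R :^ x^-1)%G _ (subvv _))).
  by rewrite /proper !conjSg.
by apply/memv_img/gfix_act; rewrite ?Lb // (subset_trans sRL).
Qed.

End FixedTrace.

Section BrauerQuotient.
Variables (k : fieldType) (gT : finGroupType) (G : {group gT}).
Variable A : galgebra k G.

(* A(Q) = A^Q / sum_(R < Q) A_R^Q, realised on a chosen linear complement of  *)
(* the ideal in A^Q and multiplied modulo the ideal; see br_surj, br_eq0,     *)
(* br_mul, br_one.  To have A(Q) for every subgroup Q of gT, Q is replaced by *)
(* Q :&: G, which is Q whenever Q \subset G.                                  *)
Section Construction.
Variable Q : {group gT}.
Local Notation D := (Q :&: G)%G.
Local Notation U := (gfix A D).
Local Notation J := (gbrauer_ker A D).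

Definition brauer_vect : vectType k := subvs_of (U :\: J)%VS.

Definition br_fun : 'Hom(A, brauer_vect) :=
  (linfun (@vsproj k A (U :\: J)%VS) \o addv_pi1 U J)%VF.

Definition br_lift_fun : 'Hom(brauer_vect, A) :=
  linfun (@vsval k A (U :\: J)%VS).

Local Notation br := br_fun.
Local Notation lift := br_lift_fun.

Fact br_sDG : D \subset G. Proof. exact: subsetIr. Qed.
Local Hint Resolve br_sDG : core.

Fact br_lift_fix v : lift v \in U.
Proof. by rewrite lfunE; apply: (subvP (diffvSl U J)) (subvsP v). Qed.
Local Hint Resolve br_lift_fix : core.

Fact br_liftK v : br (lift v) = v.
Proof.
rewrite !lfunE /= lfunE /= /addv_pi1 daddv_pi_id ?vsvalK ?subvsP //.
exact: capv_diff.
Qed.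

Fact br_liftB a : a \in U -> lift (br a) - a \in J.
Proof.
move=> Ua; rewrite lfunE /= lfunE /= lfunE /= vsprojK ?memv_pi //.
have UJa: a \in (U + J)%VS by apply: (subvP (addvSl U J)).
rewrite -{2}(addv_pi1_pi2 UJa) opprD addrA subrr add0r rpredN.
exact: memv_pi2.
Qed.

Fact br_fun_eq0 a : a \in U -> (br a == 0) = (a \in J).
Proof.
move=> Ua; apply/idP/idP => [/eqP a0 | Ja].
  by move: (br_liftB Ua); rewrite a0 linear0 sub0r rpredN.
have Jla: lift (br a) \in J by rewrite -(subrK a (lift _)) rpredD ?br_liftB.
rewrite -(inj_eq (can_inj br_liftK)) linear0 -memv0 -(capv_diff U J) memv_cap.
by rewrite Jla andbT lfunE subvsP.
Qed.

Fact br_eq a b : a \in U -> b \in U -> a - b \in J -> br a = br b.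
Proof.
move=> Ua Ub Jab; apply/eqP; rewrite -subr_eq0 -linearB br_fun_eq0 //.
exact: rpredB.
Qed.

Definition br_one_fun : brauer_vect := br 1.
Definition br_mul_fun (u v : brauer_vect) : brauer_vect := br (lift u * lift v).

Fact br_mulE a b : a \in U -> b \in U -> br (a * b) = br_mul_fun (br a) (br b).
Proof.
move=> Ua Ub; apply: br_eq; rewrite ?gfix_mul //.
have ->: a * b - lift (br a) * lift (br b)
   = - ((lift (br a) - a) * lift (br b) + a * (lift (br b) - b)).
  by rewrite mulrBl mulrBr addrA subrK opprB.
rewrite rpredN rpredD //.
  by rewrite gbrauer_ker_mulr ?br_liftB.
by rewrite gbrauer_ker_mull ?br_liftB.
Qed.

Fact br_mulA : associative br_mul_fun.
Proof.
move=> u v w.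
rewrite -[u]br_liftK -[v]br_liftK -[w]br_liftK.
by rewrite -!br_mulE ?gfix_mul // mulrA.
Qed.

Fact br_mul1 : left_id br_one_fun br_mul_fun.
Proof.
by move=> u; rewrite -{1}[u]br_liftK -br_mulE ?gfix_one // mul1r br_liftK.
Qed.

Fact br_mulr1 : right_id br_one_fun br_mul_fun.
Proof.
by move=> u; rewrite -{1}[u]br_liftK -br_mulE ?gfix_one // mulr1 br_liftK.
Qed.

Fact br_mulDl : left_distributive br_mul_fun +%R.
Proof. by move=> u v w; rewrite /br_mul_fun linearD mulrDl linearD. Qed.

Fact br_mulDr : right_distributive br_mul_fun +%R.
Proof. by move=> u v w; rewrite /br_mul_fun linearD mulrDr linearD. Qed.

Fact br_scaleAl a u v : a *: br_mul_fun u v = br_mul_fun (a *: u) v.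
Proof. by rewrite /br_mul_fun -linearZ fd_scalerAl linearZ. Qed.

Fact br_scaleAr a u v : a *: br_mul_fun u v = br_mul_fun u (a *: v).
Proof. by rewrite /br_mul_fun -linearZ fd_scalerAr linearZ. Qed.

Definition brauer_alg : fdAlgebra k :=
  FdAlgebra br_mulA br_mul1 br_mulr1 br_mulDl br_mulDr br_scaleAl br_scaleAr.

End Construction.

Definition br Q : 'Hom(A, brauer_alg Q) := br_fun Q.
Definition br_lift Q : 'Hom(brauer_alg Q, A) := br_lift_fun Q.

Section Theory.
Variable Q : {group gT}.
Hypothesis sQG : Q \subset G.

Let defD : (Q :&: G)%G = Q.
Proof. by apply: val_inj; apply/setIidPl. Qed.

Lemma br_liftP (v : brauer_alg Q) : br_lift Q v \in gfix A Q.
Proof. by rewrite -[in gfix A Q]defD; apply: br_lift_fix. Qed.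

Lemma brK (v : brauer_alg Q) : br Q (br_lift Q v) = v.
Proof. exact: br_liftK. Qed.

Lemma br_surj (v : brauer_alg Q) : exists2 a, a \in gfix A Q & br Q a = v.
Proof. by exists (br_lift Q v); rewrite ?br_liftP ?brK. Qed.

Lemma br_eq0 a : a \in gfix A Q -> (br Q a == 0) = (a \in gbrauer_ker A Q).
Proof.
rewrite -[in gfix A Q]defD => Qa.
by rewrite (br_fun_eq0 Qa) [in LHS]defD.
Qed.

Lemma br_mul a b : a \in gfix A Q -> b \in gfix A Q ->
  br Q (a * b) = br Q a * br Q b.
Proof. by rewrite -[in gfix A Q]defD; apply: br_mulE. Qed.

Lemma br_eqP a b : a \in gfix A Q -> b \in gfix A Q ->
  reflect (br Q a = br Q b) (a - b \in gbrauer_ker A Q).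
Proof.
move=> Qa Qb; rewrite -br_eq0 ?rpredB // linearB subr_eq0; exact: eqP.
Qed.

Lemma br_one : br Q 1 = 1. Proof. by []. Qed.

End Theory.

(* ^x v, in A(^x Q), for v in A(Q) and x in G *)
Definition br_conj (Q : {group gT}) (x : gT) :
    'Hom(brauer_alg Q, brauer_alg (Q :^ x^-1)%G) :=
  (br (Q :^ x^-1)%G \o (galg_act A x \o br_lift Q))%VF.

Lemma br_conj_def (Q : {group gT}) x (v : brauer_alg Q) :
  br_conj Q x v = br (Q :^ x^-1)%G (galg_act A x (br_lift Q v)).
Proof. by rewrite /br_conj [LHS]comp_lfunE; congr (fun_of_lfun _ _); rewrite comp_lfunE. Qed.

Lemma br_conjE (Q : {group gT}) x a : Q \subset G -> x \in G ->
  a \in gfix A Q -> br_conj Q x (br Q a) = br (Q :^ x^-1)%G (galg_act A x a).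
Proof.
move=> sQG Gx Qa; rewrite br_conj_def.
have sQxG: (Q :^ x^-1 \subset G)%g by rewrite -(conjGid (groupVr Gx)) conjSg.
have Qla := br_liftP sQG (br Q a).
apply: (elimT (br_eqP sQxG (gfix_act sQG Gx Qla) (gfix_act sQG Gx Qa))).
rewrite -linearB gbrauer_ker_act //.
by apply: (introT (br_eqP sQG Qla Qa)); rewrite brK.
Qed.

(* The action of N_G(Q) on A(Q) *)
Definition br_act (Q : {group gT}) (x : gT) : 'End(brauer_alg Q) :=
  (br Q \o (galg_act A x \o br_lift Q))%VF.

Lemma br_act_def (Q : {group gT}) x (v : brauer_alg Q) :
  br_act Q x v = br Q (galg_act A x (br_lift Q v)).
Proof. by rewrite /br_act [LHS]comp_lfunE; congr (fun_of_lfun _ _); rewrite comp_lfunE. Qed.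

Section Action.
Variable Q : {group gT}.
Local Notation D := (Q :&: G)%G.

Fact br_act_fix x a : x \in 'N_G(Q)%g -> a \in gfix A D ->
  galg_act A x a \in gfix A D.
Proof.
move=> /setIP[Gx Nx] Da.
have Nxi: x^-1%g \in 'N(Q)%g by rewrite groupV.
have defDx : (D :^ x^-1)%g = D.
  by rewrite /= conjIg (normP Nxi) conjGid ?groupV.
by rewrite -[gval D]defDx; apply: gfix_act; rewrite ?br_sDG.
Qed.

Fact br_actE x a : x \in 'N_G(Q)%g -> a \in gfix A D ->
  br_act Q x (br Q a) = br Q (galg_act A x a).
Proof.
move=> Nx Da; rewrite br_act_def; have Dla := br_lift_fix (br Q a).
apply: br_eq; rewrite ?br_act_fix // -linearB.
have [Gx NQx] := setIP Nx; have Nxi: x^-1%g \in 'N(Q)%g by rewrite groupV.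
have defDx : (D :^ x^-1)%G = D.
  by apply: val_inj; rewrite /= conjIg (normP Nxi) conjGid ?groupV.
rewrite -[X in gbrauer_ker A (gval X)]defDx.
by apply: gbrauer_ker_act; rewrite ?br_sDG ?br_liftB.
Qed.

Fact br_act1 v : br_act Q 1%g v = v.
Proof. by rewrite br_act_def galg_act1 brK. Qed.

Fact br_actM x y : x \in 'N_G(Q)%G -> y \in 'N_G(Q)%G ->
  forall v, br_act Q (x * y)%g v = br_act Q x (br_act Q y v).
Proof.
move=> Nx Ny v; rewrite -[v]brK !br_actE ?groupM ?br_act_fix ?br_lift_fix //.
by have [/setIP[Gx _] /setIP[Gy _]] := (Nx, Ny); rewrite galg_actM.
Qed.

Fact br_act_mul x : x \in 'N_G(Q)%G ->
  forall u v, br_act Q x (u * v) = br_act Q x u * br_act Q x v.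
Proof.
move=> Nx u v; have Gx: x \in G by case/setIP: Nx.
have brM (a b : A) : a \in gfix A D -> b \in gfix A D ->
  br Q (a * b) = br Q a * br Q b by apply: br_mulE.
rewrite -[u]brK -[v]brK -brM ?br_lift_fix //.
rewrite !br_actE ?gfix_mul ?br_lift_fix ?br_sDG //.
by rewrite galg_act_mul // brM ?br_act_fix ?br_lift_fix.
Qed.

Fact br_act_one x : x \in 'N_G(Q)%G -> br_act Q x 1 = 1.
Proof.
move=> Nx; have Gx: x \in G by case/setIP: Nx.
by rewrite -[1 in LHS]/(br Q 1) br_actE ?gfix_one ?br_sDG // galg_act_one.
Qed.

Definition brauer_quot : galgebra k 'N_G(Q)%G :=
  GAlgebra br_act1 br_actM br_act_mul br_act_one.

End Action.

End BrauerQuotient.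

Section SubGAlgebra.
Variables (k : fieldType) (gT : finGroupType) (G : {group gT}).
Variable A : galgebra k G.

Section Restriction.
Variable H : {group gT}.
Hypothesis sHG : H \subset G.

Fact res_actM x y : x \in H -> y \in H ->
  forall a, galg_act A (x * y)%g a = galg_act A x (galg_act A y a).
Proof. by move=> Hx Hy; apply: galg_actM; apply: (subsetP sHG). Qed.

Fact res_act_mul x : x \in H ->
  forall a b, galg_act A x (a * b) = galg_act A x a * galg_act A x b.
Proof. by move=> Hx; apply: galg_act_mul; apply: (subsetP sHG). Qed.

Fact res_act_one x : x \in H -> galg_act A x 1 = 1.
Proof. by move=> Hx; apply: galg_act_one; apply: (subsetP sHG). Qed.

Definition res_galg : galgebra k H :=
  GAlgebra (galg_act1 (g := A)) res_actM res_act_mul res_act_one.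

End Restriction.

Section Stabilizer.
Variable a : A.

Definition gstab_set : {set gT} := [set x in G | galg_act A x a == a].

Fact gstab_group_set : group_set gstab_set.
Proof.
apply/group_setP; split=> [|x y]; first by rewrite inE group1 galg_act1 /=.
rewrite !inE => /andP[Gx /eqP ax] /andP[Gy /eqP ay].
by rewrite groupM // galg_actM // ay ax /=.
Qed.

Definition gstab : {group gT} := Group gstab_group_set.

Lemma gstab_sub : gstab \subset G.
Proof. by apply/subsetP => x; rewrite inE => /andP[]. Qed.

End Stabilizer.

End SubGAlgebra.

Definition primitive_in (k : fieldType) (A : fdAlgebra k) (V : {vspace A}) :=
  primitive_idempotent (fun a : A => a \in V).

Section Hypotheses.
Variables (k : fieldType) (gT : finGroupType) (G : {group gT}).
Variable A : galgebra k G.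

Definition p_permutation (p : nat) :=
  forall P : {group gT}, P \subset G -> (p.-group P)%g ->
    exists2 X : seq A, basis_of {:A}%VS X
      & forall x v, x \in P -> v \in X -> galg_act A x v \in X.

(* ^x f in kN: the basis element n is sent to x n x^-1 *)
Definition ga_conj (N : {group gT}) (x : gT)
    (f : group_algebra k (subg_of N)) : group_algebra k (subg_of N) :=
  [ffun n : subg_of N => f (subg N (sgval n ^ x)%g)].

Record interior (N : {group gT}) := Interior {
  int_map :> {linear group_algebra k (subg_of N) -> A};
  int_monoid : monoid_morphism int_map;
  int_equivariant : forall x f, x \in G ->
    int_map (ga_conj x f) = galg_act A x (int_map f);
  int_conj : forall (n : subg_of N) a,
    galg_act A (sgval n) a
      = int_map (ga_elt k n) * a * int_map (ga_elt k (n^-1)%g)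
}.

Definition defect_group (p : nat) (N : {group gT}) (c : A) (Q : {group gT}) :=
  [/\ Q \subset N, (p.-group Q)%g, c \in gtrace_img A Q N & br A Q c != 0].

End Hypotheses.

Section BrauerPairs.
Variables (k : fieldType) (gT : finGroupType) (G : {group gT}).
Variable A : galgebra k G.

Record bpair := BPair {
  bp_grp : {group gT};
  bp_blk : brauer_quot A bp_grp
}.

(* (A,c,G)-Brauer pairs; A is a p-permutation G-algebra and c a primitive     *)
(* idempotent of A^G.                                                         *)
Definition brauer_pair (p : nat) (c : A) (P : bpair) :=
  [/\ p_permutation A p /\ primitive_in (gfix A G) c,
      bp_grp P \subset G, (p.-group (bp_grp P))%g, block (bp_blk P)
    & br A (bp_grp P) c * bp_blk P != 0].

Definition bp_le (P S : bpair) :=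
  bp_grp P \subset bp_grp S /\
  forall i, primitive_in (gfix A (bp_grp S)) i ->
    br A (bp_grp S) i * bp_blk S != 0 -> br A (bp_grp P) i * bp_blk P != 0.

Definition maximal_brauer_pair (p : nat) (c : A) (P : bpair) :=
  brauer_pair p c P /\
  forall S, brauer_pair p c S -> bp_le P S -> S = P.

(* the set of (A,c,G)-Brauer pairs above Q *)
Definition brauer_pair_above (p : nat) (c : A) (Q P : bpair) :=
  [/\ brauer_pair p c Q, brauer_pair p c P & bp_le Q P].

(* ^x(R, e); recall that R :^ x^-1 is x R x^-1 *)
Definition bp_conj (x : gT) (P : bpair) : bpair :=
  BPair (br_conj A (bp_grp P) x (bp_blk P)).

End BrauerPairs.

Section BrauerPairTheory.
Variables (k : fieldType) (gT : finGroupType) (G : {group gT}).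
Variable A : galgebra k G.
Implicit Types (P R S T : bpair A).

Section Idempotents.
Variable L : {group gT}.
Hypothesis sLG : L \subset G.

Definition lmul_fun (e : A) : 'End(A) := linfun (fun a : A => e * a).

Lemma lmul_funE e a : lmul_fun e a = e * a.
Proof.
pose f (a : A) : A := e * a.
have lin_f : linear f by move=> b u v; rewrite /f mulrDr -fd_scalerAr.
pose lf := GRing.isLinear.Build k A A *:%R f lin_f.
pose F : {linear A -> A} := HB.pack f lf.
exact: (lfunE F a).
Qed.

Lemma primitive_summand (e : A) (Q : A -> Prop) :
    e \in gfix A L -> e * e = e -> Q e -> ~ Q 0 ->
    (forall i j, i \in gfix A L -> j \in gfix A L -> Q (i + j) -> Q i \/ Q j) ->
  exists2 i, primitive_in (gfix A L) i & [/\ e * i = i, i * e = i & Q i].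
Proof.
move=> + + + nQ0 QD; move: {2}(\dim (limg (lmul_fun e))) (leqnn (\dim (limg (lmul_fun e)))) => n.
elim: n e => [|n IHn] e len Le ee Qe.
  exfalso; apply: nQ0; suff <-: e = 0 by [].
  move: len; rewrite leqn0 dimv_eq0 => /eqP e0; apply/eqP.
  by rewrite -memv0 -e0 -{1}ee -lmul_funE memv_img ?memvf.
have [prim_e | nprim] := classic (primitive_in (gfix A L) e).
  by exists e; rewrite ?ee.
have [i [j [Li Lj [ii jj ij ji] [def_e ni nj]]]] :
    exists i j, [/\ i \in gfix A L, j \in gfix A L,
      [/\ i * i = i, j * j = j, i * j = 0 & j * i = 0]
      & [/\ e = i + j, i <> 0 & j <> 0]].
  apply: NNPP => no; apply: nprim; split=> //.
    by apply/eqP => e0; apply: nQ0; rewrite -e0.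
  move=> i j Li Lj ii jj ij ji def_e.
  have [/eqP i0 | /eqP ni] := boolP (i == 0); first by left.
  have [/eqP j0 | /eqP nj] := boolP (j == 0); first by right.
  by case: no; exists i, j.
have rec i' j' : i' \in gfix A L -> i' * i' = i' -> j' * j' = j' -> 
    i' * j' = 0 -> j' * i' = 0 -> e = i' + j' -> j' <> 0 -> Q i' ->
  exists2 i, primitive_in (gfix A L) i & [/\ e * i = i, i * e = i & Q i].
  move=> Li' ii' jj' ij' ji' def_e' nj' Qi'.
  have ei': e * i' = i' by rewrite def_e' mulrDl ii' ji' addr0.
  have ie': i' * e = i' by rewrite def_e' mulrDr ii' ij' addr0.
  have ej': e * j' = j' by rewrite def_e' mulrDl ij' jj' add0r.
  have [] := IHn i' _ Li' ii' Qi'.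
    rewrite -ltnS; apply: leq_trans len.
    rewrite (ltn_leqif (dimv_leqif_sup _)).
      apply/negP => /subvP/(_ j'); rewrite -{1}ej' -{1}lmul_funE memv_img ?memvf //.
      case/(_ isT)/memv_imgP => a _; rewrite lmul_funE => def_j.
      by apply: nj'; rewrite -ij' def_j mulrA ii'.
    apply/subvP => _ /memv_imgP[a _ ->]; rewrite lmul_funE -ei' -mulrA -lmul_funE.
    by rewrite memv_img ?memvf.
  move=> i0 prim_i0 [ii0 i0i Qi0]; exists i0 => //.
  by rewrite -ii0 mulrA ei' ii0; split=> //; rewrite -i0i -mulrA ie'.
have [Qi | Qj] : Q i \/ Q j by apply: QD; rewrite // -def_e.
  exact: (rec i j).
by apply: (rec j i); rewrite // addrC.
Qed.

End Idempotents.

Lemma bp_le_trans R S T : bp_grp T \subset G ->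
  bp_le R S -> bp_le S T -> bp_le R T.
Proof.
move=> sTG [sRS leRS] [sST leST]; split=> [|i prim_i fi].
  exact: subset_trans sST.
have sSG: bp_grp S \subset G by apply: subset_trans sTG.
have sRG: bp_grp R \subset G by apply: subset_trans sSG.
have [Ti ii _ _] := prim_i.
have Si: i \in gfix A (bp_grp S) by apply: (subvP (gfixS A sST)).
have Ri: i \in gfix A (bp_grp R) by apply: (subvP (gfixS A sRS)).
have nz := leST i prim_i fi.
pose Q a := br A (bp_grp S) a * bp_blk S != 0.
have [| |i' prim_i' [ii' i'i Qi']] := @primitive_summand _ i Q Si ii nz.
- by rewrite /Q linear0 mul0r eqxx.
- move=> a b _ _; rewrite /Q linearD mulrDl => nab.
  have [/eqP a0 | na] := boolP (br A (bp_grp S) a * bp_blk S == 0).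
    by right; rewrite a0 add0r in nab.
  by left.
have Ri': i' \in gfix A (bp_grp R).
  by apply: (subvP (gfixS A sRS)); case: prim_i'.
apply/eqP => i0; have := leRS i' prim_i' Qi'.
by rewrite -i'i (br_mul sRG Ri' Ri) -mulrA i0 mulr0 eqxx.
Qed.

Lemma br_conj_mul (Q : {group gT}) x (u v : brauer_alg A Q) :
  Q \subset G -> x \in G ->
  br_conj A Q x (u * v) = br_conj A Q x u * br_conj A Q x v.
Proof.
move=> sQG Gx.
have sQxG: (Q :^ x^-1)%G \subset G by rewrite -(conjGid (groupVr Gx)) conjSg.
have Lu := br_liftP sQG u; have Lv := br_liftP sQG v.
rewrite -[u]brK -[v]brK -br_mul // !br_conjE ?gfix_mul //.
by rewrite galg_act_mul // br_mul ?gfix_act.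
Qed.

Lemma br_conj_eq0 (Q : {group gT}) x (v : brauer_alg A Q) :
  Q \subset G -> x \in G -> (br_conj A Q x v == 0) = (v == 0).
Proof.
move=> sQG Gx; apply/eqP/eqP => [|->]; last by rewrite linear0.
have sQxG: (Q :^ x^-1)%G \subset G by rewrite -(conjGid (groupVr Gx)) conjSg.
have Lv := br_liftP sQG v; rewrite -[v]brK br_conjE // => /eqP.
rewrite br_eq0 ?gfix_act // => Jv; apply/eqP; rewrite br_eq0 //.
have Gxi: x^-1%g \in G by rewrite groupV.
have := gbrauer_ker_act sQxG Gxi Jv.
by rewrite (galg_actK _ Gx) /= -conjsgM mulgV conjsg1.
Qed.

Lemma primitive_act (L : {group gT}) x i : L \subset G -> x \in G ->
  primitive_in (gfix A L) i ->
  primitive_in (gfix A (L :^ x^-1)%G) (galg_act A x i).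
Proof.
move=> sLG Gx [Li ii ni prim_i]; have Gxi: x^-1%g \in G by rewrite groupV.
have sLxG: (L :^ x^-1)%G \subset G by rewrite -(conjGid (groupVr Gx)) conjSg.
have back a : a \in gfix A (L :^ x^-1)%G -> galg_act A x^-1%g a \in gfix A L.
  by move/(gfix_act sLxG Gxi); rewrite /= -conjsgM mulgV conjsg1.
split; first exact: gfix_act.
- by rewrite -galg_act_mul // ii.
- by apply: contra ni => /eqP xi0; rewrite -(galg_actK i Gx) xi0 linear0.
move=> a b La Lb aa bb ab ba def_i.
have def_i' : i = galg_act A x^-1%g a + galg_act A x^-1%g b.
  by rewrite -linearD /= -def_i (galg_actK _ Gx).
have [| | | | a0 | b0] := prim_i _ _ (back a La) (back b Lb) _ _ _ _ def_i';
  rewrite -?galg_act_mul ?aa ?bb ?ab ?ba ?linear0 //.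
  by left; rewrite -(galg_actKV a Gx) a0 linear0.
by right; rewrite -(galg_actKV b Gx) b0 linear0.
Qed.

Lemma bp_le_conj x R S : bp_grp S \subset G -> x \in G ->
  bp_le R S -> bp_le (bp_conj x R) (bp_conj x S).
Proof.
move=> sSG Gx [sRS leRS]; split=> [|i prim_i]; first by rewrite conjSg.
have sRG: bp_grp R \subset G by apply: subset_trans sSG.
have Gxi: x^-1%g \in G by rewrite groupV.
have sSxG: (bp_grp S :^ x^-1)%G \subset G.
  by rewrite -(conjGid (groupVr Gx)) conjSg.
pose i' := galg_act A x^-1%g i.
have prim_i' : primitive_in (gfix A (bp_grp S)) i'.
  have := primitive_act sSxG Gxi prim_i.
  by rewrite /= -conjsgM mulgV conjsg1.
have [Si' _ _ _] := prim_i'.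
have Ri' : i' \in gfix A (bp_grp R) by apply: (subvP (gfixS A sRS)).
have def_i : i = galg_act A x i' by rewrite (galg_actKV _ Gx).
rewrite def_i /= -!br_conjE // -!br_conj_mul // !br_conj_eq0 //.
exact: leRS.
Qed.

Lemma BPair_eq (Q R : {group gT}) a b : gval Q = gval R -> a = b ->
  BPair (br A Q a : brauer_quot A Q) = BPair (br A R b : brauer_quot A R).
Proof. by move/val_inj-> => ->. Qed.

Lemma bp_conj1 P : bp_conj 1%g P = P.
Proof.
case: P => Q v; rewrite /bp_conj /= br_conj_def -[in RHS](brK v).
by apply: BPair_eq; rewrite ?galg_act1 //= invg1 conjsg1.
Qed.

Lemma bp_conjM x y P : bp_grp P \subset G -> x \in G -> y \in G ->
  bp_conj (x * y) P = bp_conj x (bp_conj y P).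
Proof.
case: P => Q v /= sQG Gx Gy; rewrite /bp_conj /=.
have sQyG: (Q :^ y^-1)%G \subset G by rewrite -(conjGid (groupVr Gy)) conjSg.
have Lv := br_liftP sQG v; rewrite -[v]brK !br_conjE ?groupM ?gfix_act //.
by apply: BPair_eq; rewrite ?galg_actM //= invMg conjsgM.
Qed.

End BrauerPairTheory.

Record category := Category {
  Ob :> Type;
  Hom : Ob -> Ob -> Type;
  idm : forall X, Hom X X;
  compm : forall X Y Z, Hom Y Z -> Hom X Y -> Hom X Z;
  compm1 : forall X Y (f : Hom X Y), compm f (idm X) = f;
  comp1m : forall X Y (f : Hom X Y), compm (idm Y) f = f;
  compmA : forall X Y Z W (h : Hom Z W) (g : Hom Y Z) (f : Hom X Y),
    compm h (compm g f) = compm (compm h g) f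
}.
Arguments idm {_} _.
Arguments compm {_ _ _ _} _ _.

Record functor (C D : category) := Functor {
  fobj :> C -> D;
  fmap : forall X Y, Hom X Y -> Hom (fobj X) (fobj Y);
  fmap_id : forall X, fmap (idm X) = idm (fobj X);
  fmap_comp : forall X Y Z (g : Hom Y Z) (f : Hom X Y),
    fmap (compm g f) = compm (fmap g) (fmap f)
}.
Arguments fmap {_ _} _ {_ _} _.

Definition functor_id (C : category) : functor C C :=
  @Functor C C (fun X => X) (fun _ _ f => f)
    (fun _ => erefl) (fun _ _ _ _ _ => erefl).

Section FunctorComp.
Variables (C D E : category) (F : functor C D) (K : functor D E).

Fact functor_comp_id X : fmap K (fmap F (idm X)) = idm (K (F X)).
Proof. by rewrite !fmap_id. Qed.

Fact functor_comp_comp X Y Z (g : Hom Y Z) (f : Hom X Y) :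
  fmap K (fmap F (compm g f)) = compm (fmap K (fmap F g)) (fmap K (fmap F f)).
Proof. by rewrite !fmap_comp. Qed.

Definition functor_comp : functor C E :=
  @Functor C E (fun X => K (F X)) (fun _ _ f => fmap K (fmap F f))
    functor_comp_id functor_comp_comp.

End FunctorComp.

Definition isomorphic_categories (C D : category) :=
  exists (F : functor C D) (K : functor D C),
    functor_comp F K = functor_id C /\ functor_comp K F = functor_id D.

Definition full_subcategory (C : category) (X : C -> Prop) : category :=
  @Category {x : C | X x} (fun x y => Hom (sval x) (sval y))
    (fun x => idm (sval x)) (fun _ _ _ g f => compm g f)
    (fun _ _ f => compm1 f) (fun _ _ f => comp1m f)
    (fun _ _ _ _ h g f => compmA h g f).

Section FusionSystem.
Variables (k : fieldType) (gT : finGroupType) (G : {group gT}).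
Variables (A : galgebra k G) (p : nat) (c : A) (U : bpair A).

Definition fusion_obj := {R : bpair A | brauer_pair p c R /\ bp_le R U}.

Implicit Types R S T : fusion_obj.
Local Notation grp S := (bp_grp (sval S)).

(* phi is c_x : S -> T, u |-> x u x^-1, for an x in G with ^x S <= T *)
Definition fusion_map S T (phi : {ffun subg_of (grp S) -> subg_of (grp T)}) :=
  exists x, [/\ x \in G, bp_le (bp_conj x (sval S)) (sval T)
              & forall u, sgval (phi u) = (x * sgval u * x^-1)%g].

Definition fusion_hom S T :=
  {phi : {ffun subg_of (grp S) -> subg_of (grp T)} | fusion_map phi}.

Lemma fusion_hom_eq S T (f g : fusion_hom S T) : sval f = sval g -> f = g.
Proof.
by case: f g => [f Pf] [g Pg] /= def_f; subst g; rewrite (proof_irrelevance _ Pf Pg).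
Qed.

Fact fusion_id_subproof S :
  fusion_map ([ffun u => u] : {ffun subg_of (grp S) -> subg_of (grp S)}).
Proof.
exists 1%g; split=> [||u]; rewrite ?group1 ?bp_conj1 //.
by rewrite ffunE mul1g invg1 mulg1.
Qed.

Definition fusion_id S : fusion_hom S S := exist _ _ (fusion_id_subproof S).

Fact fusion_comp_subproof R S T (g : fusion_hom S T) (f : fusion_hom R S) :
  fusion_map [ffun u => sval g (sval f u)].
Proof.
case: g f => [g [y [Gy leST def_g]]] [f [x [Gx leRS def_f]]] /=.
have sG (P : fusion_obj) : grp P \subset G by case: (proj2_sig P) => -[].
exists (y * x)%g; split=> [||u]; first exact: groupM.
  rewrite bp_conjM ?sG //.
  apply: bp_le_trans (sG T) _ leST; apply: bp_le_conj leRS => //.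
by rewrite ffunE def_g def_f invMg !mulgA.
Qed.

Definition fusion_comp R S T (g : fusion_hom S T) (f : fusion_hom R S) :
  fusion_hom R T := exist _ _ (fusion_comp_subproof g f).

Fact fusion_comp1 R S (f : fusion_hom R S) : fusion_comp f (fusion_id R) = f.
Proof. by apply: fusion_hom_eq; apply/ffunP=> u; rewrite /= !ffunE. Qed.

Fact fusion_1comp R S (f : fusion_hom R S) : fusion_comp (fusion_id S) f = f.
Proof. by apply: fusion_hom_eq; apply/ffunP=> u; rewrite /= !ffunE. Qed.

Fact fusion_compA Q R S T (h : fusion_hom S T) (g : fusion_hom R S)
    (f : fusion_hom Q R) :
  fusion_comp h (fusion_comp g f) = fusion_comp (fusion_comp h g) f.
Proof. by apply: fusion_hom_eq; apply/ffunP=> u; rewrite /= !ffunE. Qed.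

Definition fusion_system : category :=
  Category fusion_comp1 fusion_1comp fusion_compA.

End FusionSystem.

(* N_G(Q, f), the N_G(Q, f)-algebra A(Q), and the identification of A(R) with *)
(* A(Q)(R) for Q <= R <= N_G(Q, f).  It does not depend on the chosen lift:   *)
(* see br_identE, i.e. Br_R^{A(Q)} o Br_Q^A = Br_R^A on A^R.                  *)
Section Local.
Variables (k : fieldType) (gT : finGroupType) (G : {group gT}).
Variables (A : galgebra k G) (Q : bpair A).

Definition local_grp : {group gT} := gstab (bp_blk Q).

Definition local_galg : galgebra k local_grp := 
  res_galg (brauer_quot A (bp_grp Q)) (gstab_sub (bp_blk Q)).

Definition br_ident (R : {group gT}) (v : brauer_quot A R) :
    brauer_quot local_galg R :=
  br local_galg R (br A (bp_grp Q) (br_lift A R v)).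

Definition local_bpair (R : bpair A) : bpair local_galg :=
  BPair (br_ident (bp_blk R)).

End Local.

Section LocalTheory.
Variables (k : fieldType) (gT : finGroupType) (G : {group gT}).
Variables (A : galgebra k G) (Qf : bpair A).
Local Notation Q := (bp_grp Qf).
Local Notation H := (local_grp Qf).
Hypothesis sQG : Q \subset G.

Lemma local_grp_sub : H \subset 'N_G(Q)%g.
Proof. exact: gstab_sub. Qed.

Lemma br_gfix (K : {group gT}) a : Q \subset K -> K \subset H ->
  a \in gfix A K -> br A Q a \in gfix (local_galg Qf) K.
Proof.
move=> sQK sKH Ka; apply/gfixP => x Kx.
have Nx: x \in 'N_G(Q)%g by apply: (subsetP local_grp_sub); apply: (subsetP sKH).
rewrite [LHS]br_actE //; last first.
  by apply: (subvP (gfixS A (subset_trans (subsetIl _ _) sQK))).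
by have /gfixP-> := Ka.
Qed.

(* Mackey: a trace from a subgroup not containing Q dies in A(Q) *)
Lemma gtrace_gbrauer_ker (K R : {group gT}) b :
    Q \subset R -> R \subset 'N_G(Q)%g -> K \subset R -> ~~ (Q \subset K) ->
  b \in gfix A K -> gtrace A K R b \in gbrauer_ker A Q.
Proof.
move=> sQR sRN sKR nsQK Kb; have [sRG nQR] : R \subset G /\ (R \subset 'N(Q))%g.
  by apply/andP; rewrite -subsetI.
rewrite gtraceE.
rewrite (partition_big_imset (fun X => Q * X)%g) /=.
apply: memv_suml => _ /imsetP[X0 LX0 ->].
have [Rr defX0] := lcosets_repr sKR LX0; move: Rr defX0.
set r := repr X0 => Rr defX0.
have NQr : r \in 'N(Q)%g by apply: (subsetP nQR).
have Gr : r \in G by apply: (subsetP sRG).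
pose S := (Q :&: K :^ r^-1)%G.
have sSQ : S \subset Q by apply: subsetIl.
have prS : S \proper Q.
  rewrite properE sSQ /= subsetI subxx /=; apply: contra nsQK.
  by rewrite -sub_conjg (normP NQr).
have Sb : galg_act A r b \in gfix A S.
  apply: (subvP (gfixS A (subsetIr _ _))).
  by apply: gfix_act; rewrite // (subset_trans sKR).
pose h (Z : {set gT}) := (Z * X0)%g.
have hE q : q \in Q -> h (q *: S)%g = ((q * r) *: K)%g.
  move=> Qq; rewrite /h defX0 -mulg_set1 -!mulgA; congr (_ * _)%g.
  apply/setP=> z; apply/mulsgP/mulsgP => [[s t Ss /mulsgP[r' u]] | [r' u]].
    rewrite inE => /eqP-> Ku -> ->; case/setIP: Ss => _.
    rewrite mem_conjgV => Kst; exists r (s ^ r * u)%g; first exact: set11.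
      exact: groupM.
    by rewrite conjgE !mulgA mulgV mul1g.
  rewrite inE => /eqP-> Ku ->; exists 1%g (r * u)%g; rewrite ?group1 ?mul1g //.
  by apply/mulsgP; exists r u; rewrite ?inE.
suff -> : \sum_(X in lcosets K R | (Q * X == Q * X0)%g) galg_act A (repr X) b
   = gtrace A S Q (galg_act A r b).
  by apply: (subvP (sumv_sup S prS (subvv _))); apply: memv_img.
rewrite gtraceE.
have hL : h @: lcosets S Q = [set X in lcosets K R | (Q * X == Q * X0)%g].
  apply/setP=> X; rewrite inE; apply/imsetP/andP.
    case=> _ /lcosetsP[q Qq ->] ->; rewrite hE //; split.
      apply/lcosetsP; exists (q * r)%g; rewrite // groupM //.
      exact: (subsetP sQR).
    rewrite lcosetM -defX0 mulgA -[X in (X * _)%g == _]/(Q :* q)%g.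
    by rewrite rcoset_id.
  case=> LX /eqP eX.
  have [RX defX] := lcosets_repr sKR LX.
  have : repr X \in (Q * X0)%g.
    rewrite -eX -[repr X]mul1g mem_mulg //.
    by rewrite {2}defX lcoset_refl.
  rewrite {1}defX0 => /mulsgP[q y Qq /lcosetP[u Ku ->] def_r].
  exists (q *: S)%g; first by apply/lcosetsP; exists q.
  rewrite hE // defX def_r mulgA (lcosetM _ (q * r)%g u).
  by rewrite (lcoset_id Ku).
transitivity (\sum_(X in h @: lcosets S Q) galg_act A (repr X) b).
  by rewrite hL; apply: eq_bigl => X; rewrite inE.
rewrite big_imset /=; last first.
  move=> _ _ /lcosetsP[q Qq ->] /lcosetsP[q' Qq' ->]; rewrite !hE // => e.
  apply/lcoset_eqP; rewrite lcoset_sym.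
  have : (q' * r)%g \in ((q * r) *: K)%g by rewrite e lcoset_refl.
  rewrite !mem_lcoset invMg => Kr; rewrite inE groupM ?groupV //=.
  by rewrite mem_conjgV conjgE !mulgA in Kr *.
apply: eq_bigr => _ /lcosetsP[q Qq ->]; rewrite hE //.
have Rq : q \in R by apply: (subsetP sQR).
rewrite (repr_lcoset sRG sKR _ Kb) ?groupM //.
rewrite (repr_lcoset sQG sSQ Qq Sb) galg_actM //.
exact: (subsetP sRG).
Qed.

Lemma br_gbrauer_ker (R : {group gT}) a : Q \subset R -> R \subset H ->
  a \in gbrauer_ker A R -> br A Q a \in gbrauer_ker (local_galg Qf) R.
Proof.
move=> sQR sRH /gbrauer_kerP[b Kb ->]; rewrite linear_sum /=.
apply: memv_suml => K prK; have sKR := proper_sub prK.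
have sRN := subset_trans sRH local_grp_sub.
have [sQK | nsQK] := boolP (Q \subset K); last first.
  have := gtrace_gbrauer_ker sQR sRN sKR nsQK (Kb K prK).
  have sRG := subset_trans sRN (subsetIl _ _).
  rewrite -br_eq0 // => [/eqP-> |]; first exact: mem0v.
  by apply: (subvP (gfixS A sQR)); apply: gtrace_fix (Kb K prK).
have Qb: b K \in gfix A (Q :&: G)%G.
  by apply: (subvP (gfixS A (subset_trans (subsetIl _ _) sQK))); apply: Kb.
suff -> : br A Q (gtrace A K R (b K)) = gtrace (local_galg Qf) K R (br A Q (b K)).
  apply: (subvP (sumv_sup K prK (subvv _))); apply: memv_img.
  by apply: br_gfix => //; [apply: subset_trans sRH | apply: Kb].
rewrite !gtraceE linear_sum /=; apply: eq_bigr => X /(lcosets_repr sKR)[Rr _].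
by rewrite [RHS]br_actE // (subsetP sRN).
Qed.

Lemma br_identE (R : {group gT}) a : Q \subset R -> R \subset H ->
  a \in gfix A R ->
  br_ident Qf (br A R a) = br (local_galg Qf) R (br A Q a).
Proof.
move=> sQR sRH Ra.
have sRG := subset_trans (subset_trans sRH local_grp_sub) (subsetIl _ _).
have Rla := br_liftP sRG (br A R a).
apply: (elimT (br_eqP sRH _ _)); [exact: br_gfix | exact: br_gfix |].
rewrite -linearB br_gbrauer_ker //.
by apply: (introT (br_eqP sRG Rla Ra)); rewrite brK.
Qed.

End LocalTheory.

(* Main.v *)
Require Import Defs.
From mathcomp Require Import all_boot all_order all_fingroup all_algebra pgroup.
From Stdlib Require Import FunctionalExtensionality ProofIrrelevance.

(* Since [c] is a relative trace from [Q] to [N], any pair (R, f_R) above     *)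
(* (Q, f_Q) has R :&: N = Q; so Q is normal in R, and uniqueness of the block *)
(* below (R, f_R) makes f_Q stable under R, that is R <= H.  The same         *)
(* argument shows that an [x] in G carrying a pair above (Q, f_Q) below       *)
(* another one lies in H.  As f_Q is primitive in A(Q)^{C_N(Q)}, one has      *)
(* f_Q Br_Q(c) = f_Q, so Br_R(c) f_R is nonzero as soon as Br_R(f_Q) f_R is.  *)
(* The isomorphisms A(R) = A(Q)(R) then identify the pairs of F_1 with those  *)
(* of F_2; they preserve the order because Br_Q : A^R -> A(Q)^R is onto,      *)
(* hence maps primitive idempotents not in its kernel to primitive            *)
(* idempotents and reaches all of these.                                      *)

Set Implicit Arguments.
Unset Strict Implicit.
Unset Printing Implicit Defensive.
Import GRing.Theory.
Local Open Scope ring_scope.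

(** * Permutation bases *)

(** For each [p]-subgroup [P] of [G] the algebra has a basis permuted by [P], and Brauer
    homomorphisms can be read off it: for a subgroup [D] of [P], an element of A^D is killed by Br_D
    exactly when its coordinates at the [D]-fixed basis elements vanish ([gbrauer_ker_coordP]). For
    a [p]-group [S] with Q <= S <= N_G(Q), this gives a basis of A(Q) permuted by [S], the
    surjectivity of A^S -> A(Q)^S ([br_gfix_surj]) and the injectivity of A(S) -> A(Q)(S)
    ([br_gbrauer_ker_inj]). Applied to the trace [c], it also gives that R meets N in Q
    ([defect_group_inter]).

    Lifting idempotents along Br_Q ([primitive_image], [primitive_lift]) then gives the uniqueness
    of the block of a normal subpair ([bp_le_unique]) and the comparison of the two orders
    ([local_bp_le]). The pairs themselves are compared in [local_brauer_pairP], the conjugating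
    elements in [pair_conj_local]. Finally [fusion_transfer_iso] turns this dictionary into mutually
    inverse functors that leave the underlying group maps unchanged. *)

Lemma pgroup_sum_fix (k : fieldType) (p : nat) (aT : finGroupType)
    (D P : {group aT}) (I : finType) (to : action P I) (J : {set I})
    (phi : I -> k) :
  p \in [pchar k] -> (p.-group D)%g -> [acts D, on J | to]%g ->
  (forall i x, i \in J -> x \in D -> phi (to i x) = phi i) ->
  \sum_(i in J) phi i = \sum_(i in J | i \in 'Fix_to(D)%g) phi i.
Proof.
move=> chp pD nJD phiD; have sDP := acts_dom nJD.
rewrite (bigID (fun i => i \in 'Fix_to(D)%g)) /=.
rewrite [X in _ + X](_ : _ = 0) ?addr0 //.
rewrite (eq_bigl (fun i => i \in J :\: 'Fix_to(D)%g)); last first.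
  by move=> i; rewrite in_setD andbC.
(* The moved points split into [D]-orbits; [phi] is constant on each, and each has length divisible
   by [p], so its sum vanishes. *)
rewrite (partition_big_imset (orbit to D)) /=.
apply: big1 => _ /imsetP[x /setDP[Jx nFx] ->].
have [sOJ nOF] :
    orbit to D x \subset J /\ [disjoint orbit to D x & 'Fix_to(D)%g].
  split; first by rewrite acts_sub_orbit.
  apply/pred0P => y /=; apply/negP => /andP[/orbitP[a Da <-]].
  move/afixP=> Fa; case/negP: nFx; apply/afixP => z Dz.
  apply: (act_inj to a); rewrite -!actMin ?(subsetP sDP) //.
  have -> : (z * a = a * (z ^ a))%g by rewrite conjgE !mulgA mulgV mul1g.
  by rewrite actMin ?(subsetP sDP) ?groupJ // Fa ?groupJ.
rewrite (eq_bigl (fun i => i \in orbit to D x)); last first.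
  move=> i; rewrite in_setD; apply/andP/idP => [[_ /eqP <-] | Oi].
    exact: orbit_refl.
  rewrite (subsetP sOJ) // (disjointFr nOF) //; split=> //.
  by apply/eqP/(orbit_in_eqP sDP).
rewrite (eq_bigr (fun=> phi x)) => [|_ /orbitP[a Da <-]]; last exact: phiD.
rewrite sumr_const -mulr_natr (_ : _%:R = 0) ?mulr0 //.
apply/eqP; rewrite -(dvdn_pcharf chp) card_orbit_in //.
(* The orbit length is the index of a stabilizer, hence a power of [p]; exponent 0 would make [x] a
   fixed point, against [nFx]. *)
have [m def_m] : {m | #|D : 'C_D[x | to]|%g = (p ^ m)%N}.
  by apply: p_natP; apply: pnat_dvd (dvdn_indexg _ _) pD.
rewrite def_m; case: m def_m => [|m def_m]; last by rewrite expnS dvdn_mulr.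
rewrite expn0 => /eqP; rewrite indexg_eq1 subsetI subxx /=.
by rewrite sub_astab1_in // (negPf nFx).
Qed.

Section LeftTranslation.
Variable gT : finGroupType.

(** The inverse makes left translation a right action, as MathComp actions are. *)
Definition ltrans (X : {set gT}) (x : gT) : {set gT} := (x^-1 *: X)%g.

Fact ltrans1 X : ltrans X 1%g = X.
Proof. by rewrite /ltrans invg1 mul1g. Qed.

Fact ltransM X x y : ltrans X (x * y)%g = ltrans (ltrans X x) y.
Proof. by rewrite /ltrans invMg lcosetM. Qed.

Definition ltrans_action := TotalAction ltrans1 ltransM.

End LeftTranslation.

(** [D] permutes the cosets of [K] in [L] by left translation, and the value of [lam] on the
    corresponding term of the trace is constant on [D]-orbits. Only [D]-fixed cosets contribute, and
    there are none. This is used with [L] equal to [D] for Brauer kernels and with [L] equal to [N]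
    for the trace defining [c]. *)
Lemma gtrace_functional0 (k : fieldType) (p : nat) (gT : finGroupType)
    (G D K L : {group gT}) (A : galgebra k G) (lam : 'Hom(A, k^o)) (b : A) :
  p \in [pchar k] -> (p.-group D)%g -> L \subset G -> K \subset L ->
  D \subset L -> b \in gfix A K ->
  (forall x a, x \in D -> lam (galg_act A x a) = lam a) ->
  (forall x, x \in L -> ~~ (D \subset K :^ x^-1)%g) ->
  lam (gtrace A K L b) = 0.
Proof.
move=> chp pD sLG sKL sDL Kb lamD nDK; rewrite gtraceE linear_sum /=.
pose to := ltrans_action gT.
have imp z Y : z \in L -> Y \in lcosets K L -> (z *: Y)%g \in lcosets K L.
  move=> Lz /lcosetsP[y Ly ->].
  by rewrite -lcosetM; apply/lcosetsP; exists (z * y)%g => //; rewrite groupM.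
have actD : [acts D, on lcosets K L | to]%g.
  apply/actsP => x /(subsetP sDL) Lx X /=; rewrite /ltrans.
  apply/idP/idP => [|LX]; last by apply: imp; rewrite ?groupV.
  by move/(imp x _ Lx); rewrite lcosetKV.
rewrite (pgroup_sum_fix (phi := fun X => lam (galg_act A (repr X) b)) chp pD
  actD).
  (* If [D] fixes the coset of [x], then [D] lies in the conjugate of [K] by [x], which [nDK]
     excludes. *)
  rewrite big_pred0 // => X; apply/negbTE/negP => /andP[/lcosetsP[x Lx ->]].
  move/afixP => fixX; case/negP: (nDK x Lx); apply/subsetP => d Dd.
  have /= := fixX _ (groupVr Dd); rewrite /ltrans invgK => e.
  have : (d * x)%g \in (x *: K)%g by rewrite -e -lcosetM lcoset_refl.
  by rewrite mem_lcoset mem_conjgV conjgE.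
move=> X d LX Dd /=; have Ld := subsetP sDL _ Dd.
have [Lr defX] := lcosets_repr sKL LX.
rewrite /ltrans {1}defX -lcosetM (repr_lcoset sLG sKL _ Kb) ?groupM ?groupV //.
rewrite galg_actM ?(subsetP sLG) ?groupV //.
by rewrite lamD ?groupV.
Qed.

Section PermBasis.
Variables (k : fieldType) (p : nat) (gT : finGroupType) (G P : {group gT}).
Variables (A : galgebra k G) (I : finType) (to : action P I) (J : {set I}).
Variables (b : I -> A) (xi : I -> 'Hom(A, k^o)).

(* [b], indexed by [J], is a [P]-stable basis with coordinate functions [xi]. *)
(* MathComp actions are on the right, whence the inverse.                     *)
Definition stable_basis :=
  [/\ [acts P, on J | to]%g,
      forall x i, x \in P -> i \in J -> galg_act A x (b i) = b (to i x^-1%g),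
      forall i j, i \in J -> j \in J -> xi i (b j) = (i == j)%:R
    & forall a, a = \sum_(i in J) (xi i a : k) *: b i].

Hypotheses (chp : p \in [pchar k]) (sPG : P \subset G) (pP : (p.-group P)%g).
Hypothesis permb : stable_basis.

Lemma stable_basis_coord_act x i a : x \in P -> i \in J ->
  xi (to i x^-1%g) (galg_act A x a) = xi i a.
Proof.
have [actJ bact xib def] := permb => Px Ji.
have JP y j : y \in P -> j \in J -> to j y \in J.
  by move=> Py Jj; rewrite (acts_act actJ).
have Pxi : x^-1%g \in P by rewrite groupV.
rewrite {1}(def a) !linear_sum /= (bigD1 i) //= !linearZ /=.
rewrite bact // xib ?JP // eqxx big1 => [|j /andP[Jj nji]]; last first.
  rewrite !linearZ /= bact // xib ?JP // (inj_eq (act_inj to _)).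
  by rewrite eq_sym (negPf nji) scaler0.
by rewrite addr0 /GRing.scale /= mulr1.
Qed.

Lemma stable_basis_coord_fix (D : {group gT}) x i a : D \subset P ->
  a \in gfix A D -> x \in D -> i \in J -> xi (to i x) a = xi i a.
Proof.
move=> sDP /gfixP Da Dx Ji.
rewrite -(@stable_basis_coord_act x^-1%g i) ?groupV ?(subsetP sDP) //.
by rewrite invgK Da ?groupV.
Qed.

Lemma stable_basis_coord_inv (D : {group gT}) x i a : D \subset P -> x \in D ->
  i \in J -> i \in 'Fix_to(D)%g -> xi i (galg_act A x a) = xi i a.
Proof.
move=> sDP Dx Ji /afixP Fi.
by rewrite -{1}(Fi x^-1%g) ?groupV // stable_basis_coord_act // (subsetP sDP).
Qed.

(** Left cosets of the stabilizer correspond to points of the orbit through the inverse of a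
    representative. So the orbit sum of a moved point is a trace from a proper subgroup. *)
Lemma gtrace_orbit (D : {group gT}) i : D \subset P -> i \in J ->
  \sum_(j in orbit to D i) b j = gtrace A 'C_D[i | to]%g D (b i).
Proof.
have [actJ bact xib def] := permb => sDP Ji.
have [sDG sCD] : D \subset G /\ 'C_D[i | to]%g \subset D.
  by rewrite (subset_trans sDP) ?subsetIl.
rewrite gtraceE.
pose h (X : {set gT}) := to i (repr X)^-1%g.
have repD X : X \in lcosets 'C_D[i | to]%g D -> repr X \in P.
  by case/(lcosets_repr sCD) => /(subsetP sDP).
have -> : orbit to D i = h @: lcosets 'C_D[i | to]%g D.
  apply/setP => j; apply/orbitP/imsetP => [[d Dd <-]|[X LX ->]]; last first.
    by exists (repr X)^-1%g; rewrite // groupV; case/(lcosets_repr sCD): LX.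
  exists (d^-1 *: 'C_D[i | to])%g.
    by apply/lcosetsP; exists d^-1%g; rewrite ?groupV.
  have /lcosetP[c Cc def_r] := mem_repr _ (lcoset_refl 'C_D[i | to]%G d^-1%g).
  rewrite /h [repr _]def_r invMg invgK actMin ?(subsetP sDP) ?groupV //;
    last first.
    by case/setIP: Cc.
  by case/setIP: (groupVr Cc) => _ /setIP[_]; rewrite inE sub1set inE => /eqP->.
rewrite big_imset /=; last first.
  move=> X Y LX LY; rewrite /h => e.
  have [[DX defX] [DY defY]] :=
    (lcosets_repr sCD LX, lcosets_repr sCD LY).
  rewrite defX defY; apply/lcoset_eqP; rewrite lcoset_sym mem_lcoset inE.
  rewrite groupM ?groupV //= inE ?groupM ?groupV ?(subsetP sDP) //=.
  rewrite inE sub1set inE.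
  rewrite actMin ?groupV ?repD // e -actMin ?groupV ?repD //.
  by rewrite mulVg act1.
by apply: eq_bigr => X LX; rewrite bact // repD.
Qed.

(** Coordinates at [D]-fixed basis elements are [D]-invariant functionals, so they kill traces from
    proper subgroups. Conversely, a [D]-fixed element has constant coordinates on [D]-orbits; if
    those at fixed points vanish, it is a combination of orbit sums of moved points, which are
    proper traces. *)
Lemma gbrauer_ker_coordP (D : {group gT}) a : D \subset P -> a \in gfix A D ->
  reflect (forall i, i \in J -> i \in 'Fix_to(D)%g -> xi i a = 0)
          (a \in gbrauer_ker A D).
Proof.
have [actJ bact xib def] := permb => sDP Da.
have sDG := subset_trans sDP sPG; have pD := pgroupS sDP pP.
apply: (iffP idP) => [/gbrauer_kerP[c Kc ->] i Ji Fi | a0].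
  rewrite linear_sum big1 // => K prK.
  apply: (gtrace_functional0 chp pD sDG (proper_sub prK) (subxx D) (Kc _ prK)).
    by move=> x e Dx; apply: (stable_basis_coord_inv _ sDP).
  move=> x Dx; apply/negP => /subset_leq_card; rewrite cardJg leqNgt.
  by rewrite proper_card.
rewrite (def a) (partition_big_imset (orbit to D)) /=.
apply: memv_suml => _ /imsetP[i Ji ->].
have sOJ : orbit to D i \subset J.
  by rewrite acts_sub_orbit // (subset_trans sDP).
rewrite (eq_bigl (fun j => j \in orbit to D i)); last first.
  move=> j; apply/andP/idP => [[_ /eqP <-]|Oj]; first exact: orbit_refl.
  by rewrite (subsetP sOJ) //; split=> //; apply/eqP/(orbit_in_eqP sDP).
rewrite (eq_bigr (fun j => (xi i a : k) *: b j)); last first.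
  by move=> _ /orbitP[d Dd <-]; rewrite (stable_basis_coord_fix sDP).
rewrite -scaler_sumr.
have [Fi | nFi] := boolP (i \in 'Fix_to(D)%g).
  by rewrite a0 // scale0r mem0v.
rewrite gtrace_orbit //; apply: memvZ.
have prC : 'C_D[i | to]%G \proper D.
  by rewrite properE subsetIl subsetI subxx sub_astab1_in.
apply: (subvP (sumv_sup 'C_D[i | to]%G prC (subvv _))); apply: memv_img.
apply/gfixP => x /setIP[Dx Cx].
rewrite bact ?(subsetP sDP) //.
by case/setIP: (groupVr Cx) => _; rewrite inE sub1set inE => /eqP->.
Qed.
End PermBasis.

Section StableBasis.
Variables (k : fieldType) (gT : finGroupType) (G P : {group gT}).
Variable A : galgebra k G.

Lemma stable_basis_exists (X : seq A) : P \subset G -> basis_of {:A}%VS X ->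
    (forall x v, x \in P -> v \in X -> galg_act A x v \in X) ->
  exists n (to : action P 'I_n) (b : 'I_n -> A) (xi : 'I_n -> 'Hom(A, k^o)),
    stable_basis to [set: 'I_n] b xi.
Proof.
move=> sPG /andP[/eqP spanX freeX] actX; have uX := free_uniq freeX.
pose b (i : 'I_(size X)) : A := X`_i.
have Xb i : b i \in X by rewrite mem_nth.
have b_inj : injective b.
  by move=> i j /eqP; rewrite /b nth_uniq // => /eqP/val_inj.
(* The default [i] only makes [f] total: for [x] in [P] the stability of [X] guarantees that the
   search succeeds. *)
pose f (i : 'I_(size X)) (x : gT) : 'I_(size X) :=
  if x \in P then odflt i [pick j | b j == galg_act A x^-1%g (b i)] else i.
have bf i x : x \in P -> b (f i x) = galg_act A x^-1%g (b i).
  move=> Px; rewrite /f Px; case: pickP => [j /eqP //| no].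
  have /(nthP 0)[j ltj def_j] : galg_act A x^-1%g (b i) \in X.
    by rewrite actX ?groupV.
  by have := no (Ordinal ltj); rewrite /b /= def_j eqxx.
have f_act : is_action P f.
  split=> [x i j | x y Px Py i].
    have [Px | nPx] := boolP (x \in P); last by rewrite /f (negPf nPx).
    move/(congr1 b); rewrite !bf // => e; apply: b_inj.
    have Gx := subsetP sPG x Px.
    by rewrite -(galg_actKV (b i) Gx) e galg_actKV.
  apply: b_inj; rewrite !bf ?groupM // invMg.
  by rewrite galg_actM ?groupV ?(subsetP sPG).
pose xi i : 'Hom(A, k^o) := linfun (coord (in_tuple X) i : A -> k^o).
exists (size X), (Action f_act), b, xi.
have xiE i a : xi i a = coord (in_tuple X) i a by rewrite lfunE.
split=> [||i j _ _ | a].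
- by apply/subsetP => x Px; rewrite !inE Px; apply/subsetP => i; rewrite !inE.
- by move=> x i Px _ /=; rewrite bf ?groupV // invgK.
- by rewrite xiE (coord_free (X := in_tuple X) j i freeX) eq_sym.
rewrite (eq_bigl predT) => [|i]; last by rewrite inE.
have Xa : a \in <<in_tuple X>>%VS by rewrite spanX memvf.
rewrite {1}(coord_span Xa); apply: eq_bigr => i _.
by rewrite xiE.
Qed.

Lemma stable_basis_seq (I : finType) (to : action P I) (J : {set I})
    (b : I -> A) (xi : I -> 'Hom(A, k^o)) :
    stable_basis to J b xi ->
  exists2 X : seq A, basis_of {:A}%VS X
    & forall x v, x \in P -> v \in X -> galg_act A x v \in X.
Proof.
case=> actJ bact xib def; pose X := mktuple (fun i : 'I_#|J| => b (enum_val i)).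
have XE (i : 'I_#|J|) : X`_i = b (enum_val i) by rewrite -tnth_nth tnth_mktuple.
have Xb i : i \in J -> b i \in X.
  by move=> Ji; apply/mapP; exists (enum_rank_in Ji i);
    rewrite ?mem_enum ?enum_rankK_in.
exists X => [|x v Px /mapP[i _ ->]]; last first.
  by rewrite bact ?enum_valP // Xb // (acts_act actJ) ?groupV ?enum_valP.
apply/andP; split.
  rewrite eqEsubv subvf; apply/subvP => a _; rewrite (def a).
  by apply: memv_suml => i Ji; rewrite memvZ // memv_span // Xb.
apply/freeP => c c0 i; have := congr1 (xi (enum_val i)) c0.
rewrite linear_sum linear0 /= (bigD1 i) //= linearZ /= XE.
rewrite xib ?enum_valP // eqxx big1 => [|j nji]; last first.
  rewrite linearZ /= XE xib ?enum_valP //.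
  by rewrite (inj_eq enum_val_inj) eq_sym (negPf nji) scaler0.
by rewrite addr0 /GRing.scale /= mulr1.
Qed.

End StableBasis.

Lemma gfix_setIidl (k : fieldType) (gT : finGroupType) (G L : {group gT})
    (A : galgebra k G) : L \subset G -> gfix A (L :&: G)%G = gfix A L.
Proof. by move=> sLG; congr (gfix A _); apply/setIidPl. Qed.

(** * A permutation basis of the Brauer quotient *)

Section BrauerQuotientBasis.
Variables (k : fieldType) (p : nat) (gT : finGroupType) (G Q S : {group gT}).
Variables (A : galgebra k G) (I : finType) (to : action S I) (J : {set I}).
Variables (b : I -> A) (xi : I -> 'Hom(A, k^o)).
Hypotheses (chp : p \in [pchar k]) (pS : (p.-group S)%g).
Hypotheses (sQS : Q \subset S) (sSN : S \subset 'N_G(Q)%g).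
Hypothesis permb : stable_basis to J b xi.

Let sSG : S \subset G := subset_trans sSN (subsetIl _ _).
Let sQG : Q \subset G := subset_trans sQS sSG.
Let nQS : (S \subset 'N(Q))%g := subset_trans sSN (subsetIr _ _).

Local Notation JQ := (J :&: 'Fix_to(Q)%g).

Lemma stable_basis_fix_acts : [acts S, on JQ | to]%g.
Proof.
have [actJ _ _ _] := permb.
apply/subsetP => x Sx; rewrite !inE Sx; apply/subsetP => i /setIP[Ji Fi].
rewrite !inE (acts_act actJ) // Ji; apply/subsetP => y Qy; rewrite inE.
have nQx := subsetP nQS x Sx; have sQ := subsetP sQS.
have Qyx : (y ^ x^-1)%g \in Q by rewrite memJ_norm ?groupV.
rewrite -actMin ?(sQ y) //.
have -> : (x * y = (y ^ x^-1) * x)%g by rewrite conjgE invgK !mulgA mulgKV.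
by rewrite actMin ?(sQ (y ^ _)%g) //; move/afixP: Fi => ->.
Qed.

Lemma stable_basis_fix_gfix i : i \in JQ -> b i \in gfix A Q.
Proof.
have [_ bact _ _] := permb; case/setIP=> Ji /afixP Fi.
apply/gfixP => x Qx; rewrite bact ?(subsetP sQS) //.
by rewrite Fi ?groupV.
Qed.

(** The chosen lift of Br_Q(a) differs from [a] by an element of the Brauer kernel, where the
    coordinates at [Q]-fixed basis elements vanish. These coordinates therefore descend to A(Q). *)
Lemma brauer_quot_coord i a : i \in JQ -> a \in gfix A Q ->
  xi i (br_lift A Q (br A Q a)) = xi i a.
Proof.
case/setIP=> Ji Fi Qa; have Ql := br_liftP sQG (br A Q a).
apply/eqP; rewrite -subr_eq0 -linearB; apply/eqP.
move: Ji Fi; move: i; apply/(gbrauer_ker_coordP chp sSG pS permb sQS).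
  exact: rpredB.
by apply: (introT (br_eqP sQG Ql Qa)); rewrite brK.
Qed.

(** Modulo the Brauer kernel only the [Q]-fixed basis elements survive, and [S] permutes them
    because it normalizes [Q]. The same action [to] serves for A(Q), with a smaller index set. *)
Lemma brauer_quot_stable_basis :
  stable_basis (A := brauer_quot A Q) to JQ (fun i => br A Q (b i))
    (fun i => (xi i \o br_lift A Q)%VF).
Proof.
have [actJ bact xib def] := permb.
split=> [|x i Sx Ji|i j Ji Jj|v]; first exact: stable_basis_fix_acts.
- rewrite [LHS]br_actE ?(subsetP sSN) ?gfix_setIidl ?stable_basis_fix_gfix //.
  by rewrite bact //; case/setIP: Ji.
- rewrite comp_lfunE brauer_quot_coord ?stable_basis_fix_gfix // xib //.
    by case/setIP: Ji.
  by case/setIP: Jj.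
have Ql := br_liftP sQG v; rewrite -{1}[v]brK.
under eq_bigr => i _ do rewrite comp_lfunE -linearZ.
rewrite -linear_sum; apply: (elimT (br_eqP sQG Ql _)).
  by apply: memv_suml => i Ji; rewrite memvZ ?stable_basis_fix_gfix.
have Qs : \sum_(i in JQ) (xi i (br_lift A Q v) : k) *: b i \in gfix A Q.
  by apply: memv_suml => i Ji; rewrite memvZ ?stable_basis_fix_gfix.
apply/(gbrauer_ker_coordP chp sSG pS permb sQS); first exact: rpredB.
move=> i Ji Fi; have JQi : i \in JQ by apply/setIP.
rewrite linearB linear_sum /= (bigD1 i) //= linearZ /= xib // eqxx.
rewrite big1 => [|j /andP[/setIP[Jj _] nji]]; last first.
  by rewrite linearZ /= xib // eq_sym (negPf nji) scaler0.
by rewrite addr0 /GRing.scale /= mulr1 subrr.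
Qed.

(** Give the lift the coordinates of [v] at the [Q]-fixed basis elements and zero elsewhere. They
    are constant on [S]-orbits, so the lift is fixed by [S]. *)
Lemma br_gfix_surj v : v \in gfix (brauer_quot A Q) S ->
  exists2 a, a \in gfix A S & br A Q a = v.
Proof.
have [actJ bact xib def] := permb.
have [actQ _ _ defv] := brauer_quot_stable_basis.
move=> Sv; exists (\sum_(i in JQ) (xi i (br_lift A Q v) : k) *: b i); last first.
  rewrite [RHS]defv linear_sum; apply: eq_bigr => i _.
  by rewrite linearZ comp_lfunE.
apply/gfixP => x Sx; rewrite linear_sum.
rewrite [RHS](reindex_inj (act_inj to x^-1%g)) /=.
apply: eq_big => [i|i JQi]; first by rewrite (acts_act actQ) ?groupV.
rewrite linearZ /= bact //; last by case/setIP: JQi.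
congr ((_ : k) *: _).
have := stable_basis_coord_fix brauer_quot_stable_basis (subxx S) Sv
  (groupVr Sx) JQi.
by rewrite !comp_lfunE.
Qed.

(** Points fixed by [S] are fixed by [Q], so both kernels are tested on the same coordinates. *)
Lemma br_gbrauer_ker_inj a : a \in gfix A S ->
  br A Q a \in gbrauer_ker (brauer_quot A Q) S -> a \in gbrauer_ker A S.
Proof.
move=> Sa; have Qa := subvP (gfixS A sQS) a Sa.
have Sbr : br A Q a \in gfix (brauer_quot A Q) S.
  apply/gfixP => x Sx; rewrite [LHS]br_actE ?(subsetP sSN) ?gfix_setIidl //.
  by have /gfixP-> := Sa.
move/(gbrauer_ker_coordP chp sSN pS brauer_quot_stable_basis (subxx S) Sbr).
move=> a0.
apply/(gbrauer_ker_coordP chp sSG pS permb (subxx S) Sa) => i Ji Fi.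
have JQi : i \in JQ by rewrite inE Ji (subsetP (afixS to sQS)).
by rewrite -(brauer_quot_coord JQi Qa) -comp_lfunE a0.
Qed.

End BrauerQuotientBasis.

(** * Idempotents and blocks *)

(** More than dim A powers of [a] satisfy a linear relation; the lowest power occurring in it is a
    combination of higher ones. *)
Lemma powers_dependent (k : fieldType) (A : fdAlgebra k) (a : A) :
  exists n m, a ^+ n \in <<[seq a ^+ i | i <- iota n.+1 m]>>%VS.
Proof.
have dep j m : ~~ free [seq a ^+ i | i <- iota j m] ->
    exists n m, a ^+ n \in <<[seq a ^+ i | i <- iota n.+1 m]>>%VS.
  elim: m j => [|m IHm] j /=; first by rewrite nil_free.
  rewrite free_cons negb_and negbK => /orP[Sa | /IHm//].
  by exists j, m.
apply: (dep 0 (\dim {:A}%VS).+1).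
rewrite /free size_map size_iota; apply/negP => /eqP dimX.
have := dimvS (subvf <<[seq a ^+ i | i <- iota 0 (\dim {:A}%VS).+1]>>%VS).
by rewrite dimX ltnn.
Qed.

(** Write a^n = a^(n+1) q with [q] a polynomial in [a], and iterate. The exponent [n.+1] is positive
    so that this power of a lift of an idempotent is again a lift of it. *)
Lemma power_pi_regular (k : fieldType) (A : fdAlgebra k) (V : {vspace A})
    (a : A) :
  1 \in V -> (forall x y, x \in V -> y \in V -> x * y \in V) -> a \in V ->
  exists n y, [/\ y \in V, y * a = a * y
                & a ^+ n.+1 = a ^+ n.+1 * a ^+ n.+1 * y].
Proof.
move=> V1 VM Va; have [n [m]] := powers_dependent a.
have VX i : a ^+ i \in V by elim: i => [|i IHi]; rewrite ?expr0 // exprS VM.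
move=> Sa; have [q [Vq qa def_a]] :
    exists q, [/\ q \in V, q * a = a * q & a ^+ n = a ^+ n.+1 * q].
  set X := map _ _ in Sa; have := coord_span (X := in_tuple X) Sa.
  (* The list starts at exponent [n.+1], so factoring out this power leaves the [i]-th coefficient
     in front of [a ^+ i]. *)
  set c := coord _ => def_a; exists (\sum_i c i (a ^+ n) *: a ^+ i).
  split.
  - by apply: memv_suml => i _; rewrite memvZ.
  - rewrite mulr_suml mulr_sumr; apply: eq_bigr => i _.
    by rewrite -fd_scalerAl -fd_scalerAr -exprS -exprSr.
  rewrite [LHS]def_a mulr_sumr; apply: eq_bigr => i _.
  rewrite -fd_scalerAr -exprD; congr (_ *: _).
  have ltim : (i < m)%N
    by rewrite -(size_iota n.+1 m) -(size_map (GRing.exp a)).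
  by rewrite /= (nth_map 0) ?size_iota // nth_iota.
have qX i : q * a ^+ i = a ^+ i * q by apply: commrX.
have step j : a ^+ n.+1 = a ^+ (n.+1 + j) * q ^+ j.
  elim: j => [|j IHj]; first by rewrite addn0 expr0 mulr1.
  have -> : (n.+1 + j.+1 = j.+1 + n.+1)%N by rewrite addnC.
  rewrite [LHS]IHj (_ : n.+1 + j = j.+1 + n)%N; last by rewrite addSnnS addnC.
  by rewrite exprD def_a mulrA -exprD -mulrA -exprS.
exists n, (q ^+ n.+1); split.
- by elim: n.+1 => [|i IHi]; rewrite ?expr0 // exprS VM.
- by apply/esym; apply: commrX.
by rewrite -exprD; apply: step.
Qed.

Section Lifting.
Variables (k : fieldType) (A B : fdAlgebra k) (V : {vspace A}) (W : {vspace B}).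
Variable pi : 'Hom(A, B).
Hypotheses (V1 : 1 \in V) (VM : forall x y, x \in V -> y \in V -> x * y \in V).
Hypothesis piM : forall x y, x \in V -> y \in V -> pi (x * y) = pi x * pi y.
Hypothesis piV : forall w, w \in W -> exists2 a, a \in V & pi a = w.
Hypothesis piW : forall a, a \in V -> pi a \in W.

(** As [y] commutes with [a], the identity of [power_pi_regular] says that [a ^+ n.+1 * y] is
    idempotent. The last two clauses keep the lift inside a corner i A i that contains [a]. *)
Lemma idempotent_lift a u : a \in V -> pi a = u -> u * u = u ->
  exists e, [/\ e \in V, e * e = e, pi e = u,
    forall i, i * a = a -> i * e = e & forall i, a * i = a -> e * i = e].
Proof.
move=> Va def_u uu; have [n [y [Vy ya def_a]]] := power_pi_regular V1 VM Va.
have VX i : a ^+ i \in V by elim: i => [|i IHi]; rewrite ?expr0 // exprS VM.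
have piX i : pi (a ^+ i.+1) = u.
  by elim: i => [|i IHi]; rewrite ?expr1 // exprS piM // IHi def_u uu.
have yX i : y * a ^+ i = a ^+ i * y by apply: commrX.
exists (a ^+ n.+1 * y); split; first exact: VM.
- rewrite mulrA -[a ^+ _ * y * _]mulrA yX !mulrA.
  by rewrite -def_a.
(* Replacing [u] by the image of [a ^+ n.+1 * a ^+ n.+1] allows [y] to be absorbed. *)
- rewrite piM // piX -[in LHS](piX (n + n.+1)%N) -addSn exprD.
  by rewrite -piM ?VM // -def_a piX.
- by move=> i ia; rewrite exprS !mulrA ia.
by move=> i ai; rewrite -yX exprSr -!mulrA ai.
Qed.

Lemma primitive_image i :
  primitive_in V i -> pi i != 0 -> primitive_in W (pi i).
Proof.
move=> [Vi ii _ prim_i] ni; split=> //; first exact: piW.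
  by rewrite -piM // ii.
move=> u v Wu Wv uu vv uv vu def_i; have [a Va def_u] := piV Wu.
have iu : pi i * u = u by rewrite def_i mulrDl uu vu addr0.
have ui : u * pi i = u by rewrite def_i mulrDr uu uv addr0.
(* Compressing [a] by [i] keeps it a lift of [u], and puts the lifted idempotent [e] under [i]; then
   i = e + (i - e) contradicts primitivity unless a summand vanishes. *)
have pia : pi (i * a * i) = u by rewrite !piM ?VM // def_u iu ui.
have [|e [Ve ee pie ie ei]] := idempotent_lift _ pia uu; first by rewrite !VM.
have {ie}ie : i * e = e by apply: ie; rewrite !mulrA ii.
have {ei}ei : e * i = e by apply: ei; rewrite -!mulrA ii.
have [||||e0|ie0] := prim_i e (i - e) Ve (rpredB Vi Ve) ee.
- by rewrite mulrBl !mulrBr ii ie ei ee subrr subr0.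
- by rewrite mulrBr ei ee subrr.
- by rewrite mulrBl ie ee subrr.
- by rewrite addrC subrK.
- by left; rewrite -pie e0 linear0.
right; apply/esym/(addrI u).
by rewrite addr0 -def_i (subr0_eq ie0) pie.
Qed.

End Lifting.

(** Lift [j] to an idempotent and choose a primitive summand that [pi] does not kill; its image is a
    nonzero idempotent under [j], hence [j] itself. *)
Lemma primitive_lift (k : fieldType) (gT : finGroupType) (G L : {group gT})
    (A : galgebra k G) (B : fdAlgebra k) (W : {vspace B}) (pi : 'Hom(A, B)) j :
  L \subset G ->
  (forall x y, x \in gfix A L -> y \in gfix A L -> pi (x * y) = pi x * pi y) ->
  (forall w, w \in W -> exists2 a, a \in gfix A L & pi a = w) ->
  (forall a, a \in gfix A L -> pi a \in W) ->
  primitive_in W j -> exists2 i, primitive_in (gfix A L) i & pi i = j.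
Proof.
move=> sLG piM piV piW [Wj jj nj prim_j]; have [a La def_j] := piV j Wj.
have VM x y : x \in gfix A L -> y \in gfix A L -> x * y \in gfix A L.
  exact: gfix_mul.
have [e [Le ee pie _ _]] := idempotent_lift (gfix_one A sLG) VM piM La def_j jj.
have [|||i prim_i [ei ie ni]] :=
  @primitive_summand _ _ _ A L e (fun a => pi a != 0) Le ee.
- by rewrite pie.
- by rewrite linear0 eqxx.
- move=> x y _ _ nxy; have [x0 | nx] := eqVneq (pi x) 0; last by left.
  right; apply: contra nxy => /eqP y0.
  by rewrite linearD [X in X + _]x0 [X in _ + X]y0 addr0.
exists i => //; have [Li ii _ _] := prim_i.
have ji : j * pi i = pi i by rewrite -pie -piM // ei.
have ij : pi i * j = pi i by rewrite -pie -piM // ie.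
have pii : pi i * pi i = pi i by rewrite -piM // ii.
have [||||i0|ij0] :=
  prim_j (pi i) (j - pi i) (piW i Li) (rpredB Wj (piW i Li)) pii.
- by rewrite mulrBl !mulrBr jj ij ji pii subrr subr0.
- by rewrite mulrBr ij pii subrr.
- by rewrite mulrBl ji pii subrr.
- by rewrite addrC subrK.
- by rewrite i0 eqxx in ni.
by apply/esym/eqP; rewrite -subr_eq0 ij0.
Qed.

(** Otherwise j = j z + (j - j z) would be a proper orthogonal decomposition. *)
Lemma primitive_absorb (k : fieldType) (A : fdAlgebra k) (V : {vspace A})
    (j z : A) :
  primitive_in V j -> j * z \in V -> j * z = z * j -> z * z = z ->
  j * z != 0 -> j * z = j.
Proof.
move=> [Vj jj _ prim_j] Vjz jz zz njz; have jjz : j * (j * z) = j * z.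
  by rewrite mulrA jj.
have jzj : j * z * j = j * z by rewrite -mulrA -jz jjz.
have jzjz : j * z * (j * z) = j * z by rewrite mulrA jzj -mulrA zz.
have [||||jz0|jz0] := prim_j (j * z) (j - j * z) Vjz (rpredB Vj Vjz) jzjz.
- by rewrite mulrBl !mulrBr jj jjz jzj jzjz subrr subr0.
- by rewrite mulrBr jzj jzjz subrr.
- by rewrite mulrBl jjz jzjz subrr.
- by rewrite addrC subrK.
- by rewrite jz0 eqxx in njz.
by rewrite [RHS](subr0_eq jz0).
Qed.

Lemma block_eq (A : pzRingType) (e f : A) :
  block e -> block f -> e * f != 0 -> e = f.
Proof.
have key (e' f' : A) : block e' -> block f' -> e' * f' != 0 -> e' = e' * f'.
  move=> [Ze ee _ prim_e] [Zf ff _ _] nef.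
  have eef : e' * (e' * f') = e' * f' by rewrite mulrA ee.
  have efe : e' * f' * e' = e' * f' by rewrite -mulrA Zf eef.
  have efef : e' * f' * (e' * f') = e' * f' by rewrite mulrA efe -mulrA ff.
  have Zef : centre (e' * f') by move=> a; rewrite -mulrA Zf mulrA Ze mulrA.
  have [|||||ef0|ef0] := prim_e (e' * f') (e' - e' * f') Zef _ efef.
  - by move=> a; rewrite mulrBl mulrBr Zef Ze.
  - by rewrite mulrBl !mulrBr ee eef efe efef subrr subr0.
  - by rewrite mulrBr efe efef subrr.
  - by rewrite mulrBl eef efef subrr.
  - by rewrite addrC subrK.
  - by rewrite ef0 eqxx in nef.
  exact: (subr0_eq ef0).
move=> be bf nef; have [Ze _ _ _] := be.
by rewrite [LHS](key e f) // Ze -key // -Ze.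
Qed.

Lemma primitive_bij (k : fieldType) (A B : fdAlgebra k) (phi : 'Hom(A, B))
    (S : A -> Prop) (T : B -> Prop) (e : A) :
  injective phi -> (forall w, exists v, phi v = w) ->
  {morph phi : x y / x * y} -> (forall x, S x <-> T (phi x)) ->
  primitive_idempotent S e <-> primitive_idempotent T (phi e).
Proof.
move=> phiI phiV phiM ST.
have phi0 a : (phi a == 0) = (a == 0) by rewrite -(inj_eq phiI) linear0.
split=> -[Se ee ne prim_e].
  split; rewrite ?phi0 -?phiM ?ee //; first exact/ST.
  move=> i' j'; have [i <-] := phiV i'; have [j <-] := phiV j'.
  move=> /ST Si /ST Sj ii jj ij ji def_e.
  have [|||||i0|j0] := prim_e i j Si Sj;
    try by apply: phiI; rewrite ?phiM ?linear0 ?linearD.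
    by left; rewrite i0 linear0.
  by right; rewrite j0 linear0.
split; rewrite -?phi0 //; [exact/ST | by apply: phiI; rewrite phiM |].
move=> i j /ST Si /ST Sj ii jj ij ji def_e.
have [|||||/eqP i0|/eqP j0] := prim_e _ _ Si Sj.
- by rewrite -phiM ii.
- by rewrite -phiM jj.
- by rewrite -phiM ij linear0.
- by rewrite -phiM ji linear0.
- by rewrite def_e linearD.
- by left; apply/eqP; rewrite -phi0.
by right; apply/eqP; rewrite -phi0.
Qed.

Lemma block_bij (k : fieldType) (A B : fdAlgebra k) (phi : 'Hom(A, B)) (e : A) :
  injective phi -> (forall w, exists v, phi v = w) ->
  {morph phi : x y / x * y} -> block e <-> block (phi e).
Proof.
move=> phiI phiV phiM; apply: primitive_bij => // z; split=> Zz a.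
  by have [b <-] := phiV a; rewrite -!phiM Zz.
by apply: phiI; rewrite !phiM Zz.
Qed.

Lemma block_act (k : fieldType) (gT : finGroupType) (G : {group gT})
    (A : galgebra k G) x (e : A) :
  x \in G -> block e -> block (galg_act A x e).
Proof.
move=> Gx; apply (block_bij (phi := galg_act A x)).
- by apply: (can_inj (g := galg_act A x^-1)) => a; rewrite galg_actK.
- by move=> w; exists (galg_act A x^-1%g w); rewrite galg_actKV.
exact: galg_act_mul.
Qed.

(** * The sum of the conjugates of a block *)

Section OrbitIdempotent.
Variables (k : fieldType) (gT : finGroupType) (G S : {group gT}).
Variables (A : galgebra k G) (e : A).
Hypotheses (sSG : S \subset G) (block_e : block e).
Local Notation T := (S :&: gstab e)%G.
Local Notation eps := (gtrace A T S e).

Lemma gfix_gstab : e \in gfix A T.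
Proof. by apply/gfixP => x /setIP[_]; rewrite inE => /andP[_ /eqP]. Qed.

Lemma orbit_idempotent_fix : eps \in gfix A S.
Proof. by apply: gtrace_fix; rewrite ?subsetIl // gfix_gstab. Qed.

Lemma orbit_idempotent_centre : centre eps.
Proof.
move=> a; rewrite gtraceE mulr_suml mulr_sumr; apply: eq_bigr => X LX.
have [Sr _] := lcosets_repr (subsetIl S (gstab e)) LX.
have [Z _ _ _] := block_act (subsetP sSG _ Sr) block_e.
exact: Z.
Qed.

(** Distinct conjugates of a block are blocks with product zero, so only the trivial coset
    contributes. *)
Lemma block_orbit_idempotent : e * eps = e.
Proof.
have sTS : T \subset S := subsetIl _ _; have [_ ee _ _] := block_e.
have LT : gval T \in lcosets T S.
  by apply/lcosetsP; exists 1%g; rewrite ?group1 // mul1g.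
rewrite gtraceE mulr_sumr (bigD1 _ LT) /= big1 ?addr0.
  have /gfixP fixT := gfix_gstab.
  by rewrite fixT //; apply: (mem_repr 1%g); apply: (group1 T).
move=> X /andP[LX nXT]; have [Sr defX] := lcosets_repr sTS LX.
have Gr := subsetP sSG _ Sr.
apply/eqP; apply: contraNT nXT => /(block_eq block_e (block_act Gr block_e)) def_e.
by rewrite defX lcoset_id // !inE Sr Gr -def_e /=.
Qed.

Lemma orbit_idempotentK : eps * eps = eps.
Proof.
rewrite {1}gtraceE mulr_suml [RHS]gtraceE; apply: eq_bigr => X LX.
have [Sr _] := lcosets_repr (subsetIl S (gstab e)) LX.
have Gr := subsetP sSG _ Sr.
have /gfixP fix_eps := orbit_idempotent_fix.
by rewrite -[in LHS](fix_eps _ Sr) -galg_act_mul // block_orbit_idempotent.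
Qed.

End OrbitIdempotent.

(** * Brauer pairs *)

Section NormalPairs.
Variables (k : fieldType) (p : nat) (gT : finGroupType) (G Q S : {group gT}).
Variable A : galgebra k G.
Hypotheses (chp : p \in [pchar k]) (permA : p_permutation A p).
Hypotheses (pS : (p.-group S)%g) (sQS : Q \subset S) (sSN : S \subset 'N_G(Q)%g).

Local Notation AQ := (brauer_quot A Q).
Let sSG : S \subset G := subset_trans sSN (subsetIl _ _).
Let sQG : Q \subset G := subset_trans sQS sSG.

Lemma br_gfix_surj_perm v : v \in gfix AQ S ->
  exists2 a, a \in gfix A S & br A Q a = v.
Proof.
have [X basX actX] := permA sSG pS.
have [n [to [b [xi permb]]]] := stable_basis_exists sSG basX actX.
exact: (br_gfix_surj chp pS sQS sSN permb).
Qed.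

Lemma br_gbrauer_ker_perm a : a \in gfix A S ->
  br A Q a \in gbrauer_ker AQ S -> a \in gbrauer_ker A S.
Proof.
have [X basX actX] := permA sSG pS.
have [n [to [b [xi permb]]]] := stable_basis_exists sSG basX actX.
exact: (br_gbrauer_ker_inj chp pS sQS sSN permb).
Qed.

Lemma br_gfix_norm a : a \in gfix A S -> br A Q a \in gfix AQ S.
Proof.
move=> Sa; apply/gfixP => x Sx.
rewrite [LHS]br_actE ?(subsetP sSN) ?gfix_setIidl ?(subvP (gfixS A sQS)) //.
by have /gfixP-> := Sa.
Qed.

Lemma br_mul_norm a b : a \in gfix A S -> b \in gfix A S ->
  br A Q (a * b) = br A Q a * br A Q b.
Proof. by move=> Sa Sb; rewrite br_mul // (subvP (gfixS A sQS)). Qed.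

(** Br_Q maps A^S onto A(Q)^S, and it cannot kill [i], since Br_S factors through it. *)
Lemma br_primitive i : primitive_in (gfix A S) i -> br A S i != 0 ->
  primitive_in (gfix AQ S) (br A Q i).
Proof.
move=> prim_i ni; have [Si _ _ _] := prim_i.
apply: (primitive_image (V := gfix A S)) => //.
- exact: gfix_one.
- by move=> x y; apply: gfix_mul.
- exact: br_mul_norm.
- exact: br_gfix_surj_perm.
- exact: br_gfix_norm.
apply: contra ni => /eqP i0; rewrite br_eq0 //.
by apply: br_gbrauer_ker_perm => //; rewrite i0 mem0v.
Qed.

Lemma br_primitive_lift j : primitive_in (gfix AQ S) j ->
  exists2 i, primitive_in (gfix A S) i & br A Q i = j.
Proof.
apply: primitive_lift => //.
- exact: br_mul_norm.
- exact: br_gfix_surj_perm.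
exact: br_gfix_norm.
Qed.

(* If [e] were not [S]-stable, [Br_Q(i)], lying under the sum of the orbit of *)
(* [e], would be the trace of [Br_Q(i) e] from a proper subgroup of [S].      *)
Lemma br_primitive_block i (e : AQ) : block e -> primitive_in (gfix A S) i ->
    br A S i != 0 -> br A Q i * e != 0 ->
  e \in gfix AQ S /\ br A Q i * e = br A Q i.
Proof.
move=> block_e prim_i ni nie; have prim_j := br_primitive prim_i ni.
have [Si _ _ _] := prim_i; have [Sj _ _ _] := prim_j.
have [Ze ee _ _] := block_e.
set j := br A Q i in nie prim_j Sj *.
pose T := (S :&: gstab e)%G; pose eps := gtrace AQ T S e.
have Seps : eps \in gfix AQ S := orbit_idempotent_fix e sSN.
have jeps : j * eps = j.
  apply: (primitive_absorb prim_j).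
  - exact: gfix_mul.
  - by rewrite (orbit_idempotent_centre sSN block_e).
  - exact: orbit_idempotentK.
  apply: contra nie => /eqP j0; rewrite -(block_orbit_idempotent sSN block_e).
  by rewrite Ze mulrA j0 mul0r.
have [sST | nST] := boolP (S \subset T); last first.
  have sTS : T \subset S := subsetIl _ _.
  have Tj := subvP (gfixS AQ sTS) j Sj.
  case/negP: ni; rewrite br_eq0 //; apply: br_gbrauer_ker_perm => //.
  rewrite -/j -jeps /eps (gtrace_mull sSN _ sTS Sj).
  have prT : T \proper S by rewrite properE sTS.
  apply: (subvP (sumv_sup T prT (subvv _))); apply: memv_img.
  by apply: gfix_mul => //; [apply: subset_trans sSN | apply: gfix_gstab].
have Se : e \in gfix AQ S.
  by apply: (subvP (gfixS AQ sST)); apply: gfix_gstab.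
by split=> //; apply: (primitive_absorb prim_j) => //; apply: gfix_mul.
Qed.

End NormalPairs.

(** Take a primitive summand of 1 not annihilated by the block. Such an idempotent is what gives
    content to the quantifier in [bp_le]. *)
Lemma primitive_summand_block (k : fieldType) (gT : finGroupType)
    (G : {group gT}) (A : galgebra k G) (S : bpair A) :
  bp_grp S \subset G -> block (bp_blk S) ->
  exists2 i, primitive_in (gfix A (bp_grp S)) i
    & br A (bp_grp S) i * bp_blk S != 0.
Proof.
move=> sSG [_ _ nf _].
have [|||i prim_i [_ _ ni]] := @primitive_summand _ _ _ A (bp_grp S) 1
  (fun a => br A (bp_grp S) a * bp_blk S != 0) (gfix_one A sSG) (mulr1 1).
- by rewrite [br A _ 1]br_one mul1r.
- by rewrite linear0 mul0r eqxx.
- move=> x y _ _ nxy;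
  have [x0 | nx] := eqVneq (br A (bp_grp S) x * bp_blk S) 0; last by left.
  right; apply: contra nxy => /eqP y0.
  by rewrite linearD mulrDl [X in X + _]x0 [X in _ + X]y0 addr0.
by exists i.
Qed.

Section PairOrder.
Variables (k : fieldType) (p : nat) (gT : finGroupType) (G : {group gT}).
Variable A : galgebra k G.
Hypotheses (chp : p \in [pchar k]) (permA : p_permutation A p).

Lemma bp_le_block (R S : bpair A) : (p.-group (bp_grp S))%g ->
    bp_grp S \subset 'N_G(bp_grp R)%g -> block (bp_blk R) -> block (bp_blk S) ->
    bp_le R S ->
  bp_blk R \in gfix (brauer_quot A (bp_grp R)) (bp_grp S) /\
  exists i, [/\ primitive_in (gfix A (bp_grp S)) i,
    br A (bp_grp S) i * bp_blk S != 0
    & br A (bp_grp R) i * bp_blk R = br A (bp_grp R) i].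
Proof.
move=> pS sSN block_e block_f [sRS leRS].
have sSG := subset_trans sSN (subsetIl _ _).
have [i prim_i ni] := primitive_summand_block sSG block_f.
have ni' : br A (bp_grp S) i != 0.
  by apply: contra ni => /eqP->; rewrite mul0r.
have [Se ie] := br_primitive_block chp permA pS sRS sSN block_e prim_i ni'
  (leRS i prim_i ni).
by split=> //; exists i.
Qed.

(** One primitive idempotent [i] has Br_Q(i) = Br_Q(i) e and Br_Q(i) f nonzero, so e f is nonzero
    and the two blocks agree. *)
Lemma bp_le_unique (Q : {group gT}) (e f : brauer_quot A Q) (S : bpair A) :
    (p.-group (bp_grp S))%g ->
    bp_grp S \subset 'N_G(Q)%g -> block e -> block f -> block (bp_blk S) ->
  bp_le (BPair e) S -> bp_le (BPair f) S -> e = f.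
Proof.
move=> pS sSN block_e block_f block_S leeS lefS.
have [_ [i [prim_i ni ie]]] :=
  bp_le_block (R := BPair e) pS sSN block_e block_S leeS.
apply: (block_eq block_e block_f); have [_ nif] := lefS.
have := nif i prim_i ni; rewrite /= -ie -mulrA.
by apply: contra => /eqP->; rewrite mulr0.
Qed.

End PairOrder.

(** * Comparing pairs of [A] with pairs of [A(Q)] *)

Section LocalPairs.
Variables (k : fieldType) (p : nat) (gT : finGroupType) (G : {group gT}).
Variables (A : galgebra k G) (Qf : bpair A).
Hypotheses (chp : p \in [pchar k]) (permA : p_permutation A p).
Local Notation Q := (bp_grp Qf).
Local Notation H := (local_grp Qf).
Local Notation AQ := (local_galg Qf).
Hypotheses (sQG : Q \subset G) (pQ : (p.-group Q)%g).

Lemma brauer_quot_act_triv (x : gT) (v : brauer_quot A Q) : x \in Q ->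
  galg_act (brauer_quot A Q) x v = v.
Proof.
move=> Qx; have [a Qa <-] := br_surj sQG v.
have NQ : Q \subset 'N_G(Q)%g by rewrite subsetI sQG normG.
rewrite [LHS]br_actE ?(subsetP NQ) ?gfix_setIidl //.
by have /gfixP-> := Qa.
Qed.

Lemma local_grpS : Q \subset H.
Proof.
have NQ : Q \subset 'N_G(Q)%g by rewrite subsetI sQG normG.
by apply/subsetP => x Qx; rewrite inE (subsetP NQ) //= brauer_quot_act_triv /=.
Qed.

Lemma local_p_permutation : p_permutation AQ p.
Proof.
move=> P sPH pP; have sPN := subset_trans sPH (local_grp_sub Qf).
have nQP : (P \subset 'N(Q))%g := subset_trans sPN (subsetIr _ _).
(* [P] need not contain [Q], so the basis of A(Q) is taken from one stable under the [p]-group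
   PQ. *)
pose S := (P <*> Q)%G.
have pS : (p.-group S)%g by rewrite /= norm_joinEl // pgroupM pP pQ.
have sQS : Q \subset S := joing_subr _ _.
have sSN : S \subset 'N_G(Q)%g by rewrite join_subG sPN subsetI sQG normG.
have sSG := subset_trans sSN (subsetIl _ _).
have [X basX actX] := permA sSG pS.
have [n [to [b [xi permb]]]] := stable_basis_exists sSG basX actX.
have [Y basY actY] :=
  stable_basis_seq (brauer_quot_stable_basis chp pS sQS sSN permb).
by exists Y => // x v Px; apply: actY; apply: (subsetP (joing_subl P Q)).
Qed.

Section Ident.
Variable R : {group gT}.
Hypotheses (pR : (p.-group R)%g) (sQR : Q \subset R) (sRH : R \subset H).
Let sRN : R \subset 'N_G(Q)%g := subset_trans sRH (local_grp_sub Qf).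
Let sRG : R \subset G := subset_trans sRN (subsetIl _ _).

Lemma br_identM u v :
  br_ident Qf (u * v : brauer_quot A R) = br_ident Qf u * br_ident Qf v.
Proof.
have [a Ra <-] := br_surj sRG u; have [b Rb <-] := br_surj sRG v.
rewrite -br_mul // !br_identE ?gfix_mul // (br_mul_norm sQR sRN Ra Rb).
by apply: br_mul => //; apply: br_gfix.
Qed.

(** [br_ident] packaged as a linear map, so that linearity and the inverse of linear maps become
    available. *)
Definition br_ident_hom : 'Hom(brauer_quot A R, brauer_quot AQ R) :=
  (br AQ R \o (br A Q \o br_lift A R))%VF.

Lemma br_ident_homE v : br_ident_hom v = br_ident Qf v.
Proof.
rewrite /br_ident_hom [LHS]comp_lfunE; congr (fun_of_lfun _ _).
by rewrite comp_lfunE.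
Qed.

Lemma br_ident_eq0 (v : brauer_quot A R) : (br_ident Qf v == 0) = (v == 0).
Proof.
apply/eqP/eqP => [|->]; last by rewrite -br_ident_homE linear0.
have [a Ra <-] := br_surj sRG v; rewrite br_identE // => /eqP.
rewrite br_eq0 ?br_gfix // => Ja; apply/eqP; rewrite br_eq0 //.
exact: (br_gbrauer_ker_perm chp permA pR sQR sRN Ra).
Qed.

Lemma br_ident_inj : injective br_ident_hom.
Proof.
move=> u v uv; apply/eqP; rewrite -subr_eq0 -br_ident_eq0 -br_ident_homE.
by rewrite linearB /= [X in X - _]uv subrr.
Qed.

Lemma br_ident_surj w : exists v, br_ident_hom v = w.
Proof.
have [v Rv <-] := br_surj sRH w.
have [a Ra <-] := br_gfix_surj_perm chp permA pR sQR sRN Rv.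
by exists (br A R a); rewrite br_ident_homE br_identE.
Qed.

Lemma br_ident_block (v : brauer_quot A R) : block v <-> block (br_ident Qf v).
Proof.
rewrite -br_ident_homE; apply: block_bij.
- exact: br_ident_inj.
- exact: br_ident_surj.
by move=> x y; rewrite !br_ident_homE br_identM.
Qed.

(** This translates the nonvanishing conditions in [brauer_pair] and [bp_le] between [A] and
    A(Q). *)
Lemma br_ident_br_mul_eq0 a (v : brauer_quot A R) : a \in gfix A R ->
  (br AQ R (br A Q a) * br_ident Qf v == 0) = (br A R a * v == 0).
Proof. by move=> Ra; rewrite -br_identE // -br_identM br_ident_eq0. Qed.

End Ident.

(** Br_Q sends the primitive idempotents of A^S with nonzero Br_S to primitive idempotents of A(Q)^S
    and reaches all primitive ones there. Those with Br_S zero never satisfy the premise in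
    [bp_le]. *)
Lemma local_bp_le (R S : bpair A) : (p.-group (bp_grp S))%g ->
    Q \subset bp_grp R -> bp_grp S \subset H ->
  bp_le (local_bpair Qf R) (local_bpair Qf S) <-> bp_le R S.
Proof.
move=> pS sQR sSH; have sSN := subset_trans sSH (local_grp_sub Qf).
split=> -[sRS leRS]; have /= {}sRS := sRS; split=> //;
  have sQS := subset_trans sQR sRS; have sRH := subset_trans sRS sSH;
  have pR := pgroupS sRS pS; have sSG := subset_trans sSN (subsetIl _ _).
- move=> i prim_i ni; have [Si _ _ _] := prim_i.
  have Ri := subvP (gfixS A sRS) i Si.
  rewrite -(br_ident_br_mul_eq0 pR sQR sRH) //.
  apply: leRS; last by rewrite /= br_ident_br_mul_eq0.
  apply: (br_primitive chp permA pS sQS sSN prim_i).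
  by apply: contra ni => /eqP->; rewrite mul0r.
move=> j /(br_primitive_lift chp permA pS sQS sSN)[i prim_i <-].
have [Si _ _ _] := prim_i; have Ri := subvP (gfixS A sRS) i Si.
by rewrite /= !br_ident_br_mul_eq0 //; apply: leRS.
Qed.

Lemma local_bp_conj (R : bpair A) x : Q \subset bp_grp R ->
    bp_grp R \subset H -> x \in H ->
  bp_conj x (local_bpair Qf R) = local_bpair Qf (bp_conj x R).
Proof.
case: R => R v sQR sRH Hx.
have {}sQR : Q \subset R := sQR; have {}sRH : R \subset H := sRH.
rewrite /bp_conj /local_bpair [RHS]/= [LHS]/=; congr BPair.
have Nx : x \in 'N_G(Q)%g := subsetP (local_grp_sub Qf) x Hx.
have [Gx nQx] := setIP Nx.
have sRN := subset_trans sRH (local_grp_sub Qf).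
have sRG := subset_trans sRN (subsetIl _ _).
have [a Ra <-] := br_surj sRG v.
have sQRx : Q \subset (R :^ x^-1)%G.
  by rewrite /= -(normP (groupVr nQx)) conjSg.
have sRxH : (R :^ x^-1)%G \subset H.
  by rewrite -(conjGid (groupVr Hx) : (H :^ x^-1)%g = H) conjSg.
rewrite (br_identE sQG sQR sRH Ra) (br_conjE sRH Hx); last exact: br_gfix.
rewrite (br_conjE sRG Gx Ra) br_identE ?gfix_act //; congr (fun_of_lfun _ _).
by rewrite [LHS]br_actE ?gfix_setIidl ?(subvP (gfixS A sQR)).
Qed.

End LocalPairs.

(** * Functors between fusion systems *)

(** As F S = S holds only propositionally, [fmap F f] and [f] have different types; the injective
    invariant [u] compares them in the fixed type [X]. *)
Lemma functor_eq_id (C : category) (X : Type)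
    (u : forall S T : C, Defs.Hom S T -> X)
    (F : functor C C) :
  (forall S T, injective (@u S T)) -> (forall S, F S = S) ->
  (forall S T (f : Defs.Hom S T), u _ _ (fmap F f) = u _ _ f) ->
  F = functor_id C.
Proof.
case: F => fo fm fm_id fm_comp /= uI foE fmE.
have {foE}def_fo : fo = fun S => S by apply: functional_extensionality.
subst fo; have def_fm : fm = fun _ _ f => f.
  do 3!apply: functional_extensionality_dep => ?; exact/uI/fmE.
subst fm; rewrite /functor_id; congr Functor; exact: proof_irrelevance.
Qed.

Section FusionFunctor.
Variables (k : fieldType) (p : nat) (gT : finGroupType).

(** Reading a morphism as a map on all of [gT], where [subg] sends elements outside the group to 1,
    makes its type independent of the objects. *)
Definition fusion_fun (G : {group gT}) (A : galgebra k G) c (U : bpair A)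
    (S T : fusion_obj p c U) (f : fusion_hom S T) (g : gT) : gT :=
  sgval (sval f (subg (bp_grp (sval S)) g)).

Lemma fusion_fun_inj (G : {group gT}) (A : galgebra k G) c (U : bpair A)
    (S T : fusion_obj p c U) : injective (@fusion_fun G A c U S T).
Proof.
move=> f g fg; apply: fusion_hom_eq; apply/ffunP => x; apply: subg_inj.
by have /(congr1 (fun h => h (sgval x))) := fg; rewrite /fusion_fun sgvalK.
Qed.

Definition fusion_subcategory (G : {group gT}) (A : galgebra k G) (c : A)
    (U : bpair A) (X : bpair A -> Prop) :=
  full_subcategory (C := fusion_system p c U) (fun R => X (sval R)).

(** The group component is kept definitionally, so the underlying map of a morphism can be reused
    verbatim. *)
Definition bpair_map (G1 G2 : {group gT}) (A1 : galgebra k G1)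
    (A2 : galgebra k G2)
    (g : forall R : {group gT}, brauer_quot A1 R -> brauer_quot A2 R)
    (R : bpair A1) : bpair A2 := BPair (g (bp_grp R) (bp_blk R)).

Definition fusion_transfer (G1 G2 : {group gT}) (A1 : galgebra k G1)
    (A2 : galgebra k G2) (c1 : A1) (c2 : A2) (U1 : bpair A1) (U2 : bpair A2)
    (X1 : bpair A1 -> Prop) (X2 : bpair A2 -> Prop)
    (g : forall R : {group gT}, brauer_quot A1 R -> brauer_quot A2 R) :=
  (forall R, brauer_pair p c1 R -> bp_le R U1 -> X1 R ->
     [/\ brauer_pair p c2 (bpair_map g R), bp_le (bpair_map g R) U2
       & X2 (bpair_map g R)])
  /\ (forall S T x, X1 S -> X1 T -> x \in G1 -> bp_le (bp_conj x S) T ->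
        x \in G2 /\ bp_le (bp_conj x (bpair_map g S)) (bpair_map g T)).

Section Transfer.
Variables (G1 G2 : {group gT}) (A1 : galgebra k G1) (A2 : galgebra k G2).
Variables (c1 : A1) (c2 : A2) (U1 : bpair A1) (U2 : bpair A2).
Variables (X1 : bpair A1 -> Prop) (X2 : bpair A2 -> Prop).
Variable g : forall R : {group gT}, brauer_quot A1 R -> brauer_quot A2 R.
Hypothesis trg : fusion_transfer c1 c2 U1 U2 X1 X2 g.

Local Notation C1 := (fusion_subcategory c1 U1 X1).
Local Notation C2 := (fusion_subcategory c2 U2 X2).

Fact transfer_obj_subproof (S : C1) :
  brauer_pair p c2 (bpair_map g (sval (sval S)))
    /\ bp_le (bpair_map g (sval (sval S))) U2.
Proof.
by case: S => [[R [pairR leRU]] XR]; have [] := trg.1 R pairR leRU XR.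
Qed.

Fact transfer_above_subproof (S : C1) : X2 (bpair_map g (sval (sval S))).
Proof.
by case: S => [[R [pairR leRU]] XR]; have [] := trg.1 R pairR leRU XR.
Qed.

Definition transfer_obj (S : C1) : C2 :=
  exist _ (exist _ _ (transfer_obj_subproof S)) (transfer_above_subproof S).

Fact transfer_hom_subproof (S T : C1) (f : Defs.Hom S T) :
  @fusion_map k gT G2 A2 p c2 U2 (sval (transfer_obj S)) (sval (transfer_obj T))
    (sval f).
Proof.
case: f => phi [x [Gx leST def_phi]].
have [Hx leST'] := trg.2 _ _ _ (proj2_sig S) (proj2_sig T) Gx leST.
by exists x.
Qed.

Definition transfer_hom (S T : C1) (f : Defs.Hom S T) :
  Defs.Hom (transfer_obj S) (transfer_obj T) :=
  exist _ _ (transfer_hom_subproof f).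

Fact transfer_hom_id S : transfer_hom (Defs.idm S) = Defs.idm (transfer_obj S).
Proof. exact: fusion_hom_eq. Qed.

Fact transfer_hom_comp R S T (f : Defs.Hom S T) (h : Defs.Hom R S) :
  transfer_hom (Defs.compm f h) = Defs.compm (transfer_hom f) (transfer_hom h).
Proof. exact: fusion_hom_eq. Qed.

Definition transfer_functor : functor C1 C2 :=
  Functor transfer_hom_id transfer_hom_comp.

End Transfer.

Lemma fusion_obj_eq (G : {group gT}) (A : galgebra k G) c (U : bpair A) X
    (S T : fusion_subcategory c U X) :
  sval (sval S) = sval (sval T) -> S = T.
Proof.
case: S T => [[R pR] XR] [[R' pR'] XR'] /= e; subst R'.
by rewrite (proof_irrelevance _ pR pR') (proof_irrelevance _ XR XR').
Qed.

(** Both functors leave underlying maps alone, so their composites are identities as soon as [g] and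
    [h] are mutually inverse on the selected pairs. *)
Lemma fusion_transfer_iso (G1 G2 : {group gT}) (A1 : galgebra k G1)
    (A2 : galgebra k G2) (c1 : A1) (c2 : A2) (U1 : bpair A1) (U2 : bpair A2)
    (X1 : bpair A1 -> Prop) (X2 : bpair A2 -> Prop) g h :
  fusion_transfer c1 c2 U1 U2 X1 X2 g -> fusion_transfer c2 c1 U2 U1 X2 X1 h ->
  (forall R, X1 R -> bpair_map h (bpair_map g R) = R) ->
  (forall R, X2 R -> bpair_map g (bpair_map h R) = R) ->
  isomorphic_categories (fusion_subcategory c1 U1 X1)
    (fusion_subcategory c2 U2 X2).
Proof.
move=> trg trh gK hK; exists (transfer_functor trg), (transfer_functor trh).
split.
  apply: (@functor_eq_id (fusion_subcategory c1 U1 X1) (gT -> gT)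
    (fun S T f => @fusion_fun G1 A1 c1 U1 (sval S) (sval T) f)) => // [S T|S].
    exact: fusion_fun_inj.
  by apply: fusion_obj_eq; apply: gK (proj2_sig S).
apply: (@functor_eq_id (fusion_subcategory c2 U2 X2) (gT -> gT)
  (fun S T f => @fusion_fun G2 A2 c2 U2 (sval S) (sval T) f)) => // [S T|S].
  exact: fusion_fun_inj.
by apply: fusion_obj_eq; apply: hK (proj2_sig S).
Qed.

End FusionFunctor.

(** * Pairs above a defect pair *)

(** If the intersection D of P and N were larger than [Q], no conjugate of [Q] could contain it.
    Then every coordinate of the trace [c] at a [P]-fixed basis element would vanish, that is,
    Br_P(c) = 0. *)
Lemma defect_group_inter (k : fieldType) (p : nat) (gT : finGroupType)
    (G N P Q : {group gT}) (A : galgebra k G) (c : A) :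
  p \in [pchar k] -> p_permutation A p -> N \subset G -> Q \subset N ->
  P \subset G -> (p.-group P)%g -> Q \subset P -> c \in gfix A P ->
  c \in gtrace_img A Q N -> br A P c != 0 -> (P :&: N)%g = Q.
Proof.
move=> chp permA sNG sQN sPG pP sQP Pc trc nc.
have [X basX actX] := permA P sPG pP.
have [n [to [b [xi permb]]]] := stable_basis_exists sPG basX actX.
have sQD : Q \subset (P :&: N)%g by rewrite subsetI sQP.
apply/eqP; rewrite eq_sym eqEcard sQD leqNgt; apply: contra nc => ltQD.
rewrite br_eq0 //.
apply/(gbrauer_ker_coordP chp sPG pP permb (subxx P) Pc) => i Ji Fi.
have [a Qa ->] := memv_imgP trc.
have sDP : (P :&: N)%G \subset P := subsetIl _ _.
apply: (gtrace_functional0 (D := (P :&: N)%G) chp (pgroupS sDP pP) sNG sQN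
  (subsetIr _ _) Qa).
  move=> x d /(subsetP sDP) Px.
  exact: (stable_basis_coord_inv permb d (subxx P) Px Ji Fi).
move=> x _; apply/negP => /subset_leq_card.
by rewrite cardJg leqNgt ltQD.
Qed.

Section DefectPairs.
Variables (k : fieldType) (p : nat) (gT : finGroupType) (G N : {group gT}).
Variables (A : galgebra k G) (c : A) (Qf Pf : bpair A).
Local Notation Q := (bp_grp Qf).
Local Notation fQ := (bp_blk Qf).
Local Notation H := (local_grp Qf).
Local Notation AQ := (local_galg Qf).
Hypotheses (chp : p \in [pchar k]) (nNG : (N <| G)%g).
Hypotheses (pairQ : brauer_pair p c Qf) (defQ : defect_group p N c Q).
Hypothesis maxP : maximal_brauer_pair p c Pf.
Hypothesis leQP : bp_le Qf Pf.
Hypothesis prim_fQ : primitive_in (gfix (brauer_quot A Q) 'C_N(Q)%g) fQ.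

Let permA : p_permutation A p. Proof. by case: pairQ => -[]. Qed.
Let prim_c : primitive_in (gfix A G) c. Proof. by case: pairQ => -[]. Qed.
Let sQG : Q \subset G. Proof. by case: pairQ. Qed.
Let pQ : (p.-group Q)%g. Proof. by case: pairQ. Qed.
Let block_fQ : block fQ. Proof. by case: pairQ. Qed.
Let sNG : N \subset G. Proof. exact: normal_sub. Qed.
Let Gc : c \in gfix A G. Proof. by case: prim_c. Qed.

Let Lc (L : {group gT}) : L \subset G -> c \in gfix A L.
Proof. by move=> sLG; apply: (subvP (gfixS A sLG)). Qed.

Lemma pair_inter R : brauer_pair p c R -> Q \subset bp_grp R ->
  (bp_grp R :&: N)%g = Q.
Proof.
case=> _ sRG pR _ nc sQR; have [sQN _ trc _] := defQ.
apply: (defect_group_inter chp permA sNG sQN sRG pR sQR (Lc sRG) trc).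
by apply: contra nc => /eqP->; rewrite mul0r.
Qed.

Lemma pair_norm R : brauer_pair p c R -> Q \subset bp_grp R ->
  bp_grp R \subset 'N_G(Q)%g.
Proof.
move=> pairR sQR; have [_ sRG _ _ _] := pairR; rewrite subsetI sRG /=.
rewrite -(pair_inter pairR sQR) normsI ?normG //.
exact: subset_trans sRG (normal_norm nNG).
Qed.

Lemma pair_sub_local R : brauer_pair p c R -> bp_le Qf R -> bp_grp R \subset H.
Proof.
move=> pairR leQR; have [_ sRG pR block_fR _] := pairR.
have sRN := pair_norm pairR leQR.1.
have [/gfixP fR _] := bp_le_block chp permA pR sRN block_fQ block_fR leQR.
by apply/subsetP => x Rx; rewrite inE (subsetP sRN) //= fR /=.
Qed.

(** The product is a nonzero idempotent fixed by C_N(Q), and f_Q is primitive there. *)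
Lemma br_defect_mul : fQ * br A Q c = fQ.
Proof.
have sCN : ('C_N(Q))%G \subset 'N_G(Q)%g.
  rewrite subsetI (subset_trans (subsetIl _ _)) //.
  by rewrite (subset_trans (subsetIr _ _)) ?cent_sub.
have [Ze ee _ _] := block_fQ; have [Cf _ _ _] := prim_fQ.
have [_ cc _ _] := prim_c; have Qc := Lc sQG.
apply: (primitive_absorb prim_fQ).
- apply: (gfix_mul (L := 'C_N(Q)%G)) => //; apply/gfixP => x Cx.
  have Nx := subsetP sCN x Cx.
  rewrite [LHS]br_actE ?gfix_setIidl //.
  by have /gfixP-> := Gc; case/setIP: Nx.
- exact: Ze.
- by rewrite -br_mul // cc.
by rewrite Ze; case: pairQ.
Qed.

(** C_N(Q) lies in [H], so A(Q)^H is contained in the algebra where f_Q is primitive. This is what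
    allows f_Q to take the place of [c] for A(Q). *)
Lemma primitive_local_block : primitive_in (gfix AQ H) (fQ : AQ).
Proof.
have [Cf ee nf prim_f] := prim_fQ.
have sCH : ('C_N(Q))%g \subset H.
  apply/subsetP => x Cx; rewrite inE.
  have /gfixP-> // := Cf; rewrite eqxx andbT inE.
  case/setIP: Cx => Nx Cx; rewrite (subsetP sNG) //=.
  exact: (subsetP (cent_sub Q)).
have HC : (gfix AQ H <= gfix (brauer_quot A Q) 'C_N(Q)%g)%VS by exact: gfixS.
split=> //; first by apply/gfixP => x; rewrite inE => /andP[_ /eqP].
by move=> i j Hi Hj; apply: prim_f; apply: (subvP HC).
Qed.

Lemma local_brauer_pairP R : Q \subset bp_grp R -> bp_grp R \subset H ->
    (p.-group (bp_grp R))%g -> bp_le Qf R ->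
  brauer_pair p c R <-> brauer_pair p (fQ : AQ) (local_bpair Qf R).
Proof.
move=> sQR sRH pR leQR; have sRN := subset_trans sRH (local_grp_sub Qf).
have sRG := subset_trans sRN (subsetIl _ _).
have [Ze ee _ _] := block_fQ.
have Rf : fQ \in gfix (brauer_quot A Q) (bp_grp R).
  by apply/gfixP => x /(subsetP sRH); rewrite inE => /andP[_ /eqP].
(* Br_R(a) represents f_Q inside A(R). One direction uses Br_R(i) = Br_R(i) Br_R(a) for a suitable
   [i], the other Br_R(a) = Br_R(a) Br_R(c). *)
have [a Ra def_f] := br_gfix_surj_perm chp permA pR sQR sRN Rf.
have brE u v : u \in gfix A (bp_grp R) -> v \in gfix A (bp_grp R) ->
    br A Q u = br A Q v -> br A (bp_grp R) u = br A (bp_grp R) v.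
  move=> Ru Rv euv; apply/(br_ident_inj chp permA sQG pR sQR sRH).
  by rewrite !br_ident_homE // !br_identE // euv.
have mulE : (br AQ (bp_grp R) fQ * bp_blk (local_bpair Qf R) == 0)
          = (br A (bp_grp R) a * bp_blk R == 0).
  by rewrite -def_f; apply: (br_ident_br_mul_eq0 chp permA sQG pR sQR sRH).
split=> [[_ _ _ block_R nz] | [_ _ _ /= block_R nz]].
  have [_ [i [[Ri _ _ _] ni ie]]] :=
    bp_le_block chp permA pR sRN block_fQ block_R leQR.
  split=> //.
  - by split; [exact: local_p_permutation | exact: primitive_local_block].
  - exact/(br_ident_block chp permA sQG pR sQR sRH).
  rewrite mulE; apply: contra ni => /eqP a0.
  rewrite (brE i (i * a)) ?gfix_mul //; last first.
    by rewrite (br_mul_norm sQR sRN Ri Ra) def_f ie.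
  by rewrite br_mul // -mulrA a0 mulr0.
have block_fR : block (bp_blk R).
  exact/(br_ident_block chp permA sQG pR sQR sRH).
have [ZR _ _ _] := block_fR.
split=> //; rewrite mulE in nz; apply: contra nz => /eqP c0.
rewrite (brE a (a * c)) ?gfix_mul ?Lc //; last first.
  by rewrite (br_mul_norm sQR sRN Ra) ?Lc // def_f br_defect_mul.
by rewrite br_mul ?Lc // -mulrA c0 mulr0.
Qed.

Lemma local_pair_above R : Q \subset bp_grp R -> bp_grp R \subset H ->
  (p.-group (bp_grp R))%g ->
  brauer_pair_above p c Qf R <->
  brauer_pair_above p (fQ : AQ) (local_bpair Qf Qf) (local_bpair Qf R).
Proof.
move=> sQR sRH pR.
have leE := local_bp_le chp permA sQG (R := Qf) pR (subxx _) sRH.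
split=> -[_ pairR leQR].
  split; [|exact/local_brauer_pairP|exact/leE].
  apply/local_brauer_pairP => //; exact: local_grpS.
by split=> //; [apply/local_brauer_pairP => // |]; apply/leE.
Qed.

(** Total in [R], as [fusion_transfer] requires; it inverts [br_ident] when [R] is a [p]-group
    between [Q] and [H]. *)
Definition unlocal_blk (R : {group gT}) : brauer_quot AQ R -> brauer_quot A R :=
  (br_ident_hom Qf R)^-1%VF.

Local Notation unlocal := (bpair_map unlocal_blk).

Lemma local_unlocal S : (p.-group (bp_grp S))%g -> Q \subset bp_grp S ->
  bp_grp S \subset H -> local_bpair Qf (unlocal S) = S.
Proof.
case: S => S w pS sQS sSH; rewrite /local_bpair /bpair_map; congr BPair.
rewrite -br_ident_homE limg_lfunVK //.
have [v <-] := br_ident_surj chp permA sQG pS sQS sSH w.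
by rewrite memv_img ?memvf.
Qed.

Lemma unlocal_local R : (p.-group (bp_grp R))%g -> Q \subset bp_grp R ->
  bp_grp R \subset H -> unlocal (local_bpair Qf R) = R.
Proof.
case: R => R v pR sQR sRH; rewrite /local_bpair /bpair_map; congr BPair.
apply: (br_ident_inj chp permA sQG pR sQR sRH).
rewrite limg_lfunVK /= ?br_ident_homE //.
by rewrite -br_ident_homE memv_img ?memvf.
Qed.

(** The conjugate of [Q] by [x] lies in [N] and in the group of [T], hence equals [Q]. Both f_Q and
    its conjugate then give pairs on [Q] below [T], so they coincide. *)
Lemma pair_conj_local S T x : brauer_pair p c S -> brauer_pair p c T ->
  bp_le Qf S -> bp_le Qf T -> x \in G -> bp_le (bp_conj x S) T -> x \in H.
Proof.
move=> pairS pairT leQS leQT Gx leST.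
have [[_ sSG pS _ _] [_ sTG pT block_T _]] := (pairS, pairT).
have [sQN _ _ _] := defQ.
have leQxT := bp_le_trans sTG (bp_le_conj sSG Gx leQS) leST.
have defQx : (Q :^ x^-1)%g = Q.
  apply/eqP; rewrite eqEcard cardJg leqnn andbT.
  suff : (Q :^ x^-1 \subset bp_grp T :&: N)%g.
    by rewrite (pair_inter pairT leQT.1).
  rewrite subsetI; apply/andP; split; first exact: leQxT.1.
  have NGx := subsetP (normal_norm nNG) _ (groupVr Gx).
  by rewrite -(normP NGx) conjSg.
have Nx : x \in 'N_G(Q)%g.
  by rewrite inE Gx -groupV; apply/normP.
have block_xf : block (galg_act (brauer_quot A Q) x fQ) by apply: block_act.
have conj_f : bp_conj x Qf = BPair (galg_act (brauer_quot A Q) x fQ).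
  rewrite /bp_conj br_conj_def -[in RHS](brK fQ).
  rewrite [galg_act (brauer_quot A Q) x _]br_actE ?gfix_setIidl ?br_liftP //.
  exact: BPair_eq.
rewrite inE Nx; apply/eqP; rewrite conj_f in leQxT.
have sTN := pair_norm pairT leQT.1.
apply: (bp_le_unique (S := T) chp permA pT sTN block_xf block_fQ block_T leQxT).
(* Destructing [Qf] identifies it with the pair rebuilt from its components. *)
by case: (Qf) leQT.
Qed.

Let Pf' := local_bpair Qf Pf.
Let pairP : brauer_pair p c Pf. Proof. by case: maxP. Qed.
Let sPH : bp_grp Pf \subset H. Proof. exact: pair_sub_local. Qed.
Let pP : (p.-group (bp_grp Pf))%g. Proof. by case: pairP. Qed.

Lemma pair_above_sub R : brauer_pair_above p c Qf R ->
  [/\ Q \subset bp_grp R, bp_grp R \subset H & (p.-group (bp_grp R))%g].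
Proof.
case=> _ pairR leQR; have [_ _ pR _ _] := pairR.
by split=> //; [case: leQR | apply: pair_sub_local].
Qed.

Lemma local_pair_above_sub S :
    brauer_pair_above p (fQ : AQ) (local_bpair Qf Qf) S ->
  [/\ Q \subset bp_grp S, bp_grp S \subset H & (p.-group (bp_grp S))%g].
Proof. by case=> _ [_ ? ? _ _] [? _]. Qed.

Lemma local_bp_le_conj S T x : Q \subset bp_grp S -> bp_grp S \subset H ->
    Q \subset bp_grp T -> bp_grp T \subset H -> (p.-group (bp_grp T))%g ->
    x \in H ->
  bp_le (bp_conj x (local_bpair Qf S)) (local_bpair Qf T) <->
  bp_le (bp_conj x S) T.
Proof.
move=> sQS sSH sQT sTH pT Hx; rewrite local_bp_conj //.
apply: (local_bp_le chp permA sQG pT _ sTH).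
have /setIP[_ nQx] := subsetP (local_grp_sub Qf) x Hx.
by rewrite /= -(normP (groupVr nQx)) conjSg.
Qed.

Lemma local_transfer : fusion_transfer p c (fQ : AQ) Pf Pf'
  (brauer_pair_above p c Qf) (brauer_pair_above p (fQ : AQ) (local_bpair Qf Qf))
  (fun R => @br_ident k gT G A Qf R).
Proof.
split=> [R pairR leRP aboveR | S T x aboveS aboveT Gx leST].
  have [sQR sRH pR] := pair_above_sub aboveR.
  have aboveR' := (local_pair_above sQR sRH pR).1 aboveR.
  split=> //; first by case: aboveR'.
  exact: ((local_bp_le chp permA sQG pP sQR sPH).2 leRP).
have [sQS sSH pS] := pair_above_sub aboveS.
have [sQT sTH pT] := pair_above_sub aboveT.
have [[_ pairS leQS] [_ pairT leQT]] := (aboveS, aboveT).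
have Hx := pair_conj_local pairS pairT leQS leQT Gx leST; split=> //.
exact/local_bp_le_conj.
Qed.

Lemma unlocal_transfer : fusion_transfer p (fQ : AQ) c Pf' Pf
  (brauer_pair_above p (fQ : AQ) (local_bpair Qf Qf)) (brauer_pair_above p c Qf)
  unlocal_blk.
Proof.
split=> [S pairS leSP aboveS | S T x aboveS aboveT Hx leST].
  have [sQS sSH pS] := local_pair_above_sub aboveS.
  have defS := local_unlocal pS sQS sSH; rewrite -defS in leSP aboveS.
  have aboveS' := (@local_pair_above (unlocal S) sQS sSH pS).2 aboveS.
  split=> //; first by case: aboveS'.
  exact: ((local_bp_le (R := unlocal S) chp permA sQG pP sQS sPH).1 leSP).
have [sQS sSH pS] := local_pair_above_sub aboveS.
have [sQT sTH pT] := local_pair_above_sub aboveT.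
rewrite -(local_unlocal pS sQS sSH) -(local_unlocal pT sQT sTH) in leST.
have /setIP[Gx _] := subsetP (local_grp_sub Qf) x Hx; split=> //.
apply: (@local_bp_le_conj (unlocal S) (unlocal T) x sQS sSH sQT sTH pT Hx).1.
exact: leST.
Qed.

(** A pair of A(Q) above the image of [Pf] is also above the image of [Qf], so it comes from a pair
    of [A] above [Pf], which is [Pf] itself. *)
Lemma local_maximal : maximal_brauer_pair p (fQ : AQ) Pf'.
Proof.
have aboveP : brauer_pair_above p c Qf Pf by split.
have [sQP _ _] := pair_above_sub aboveP.
have [pairQ' pairP' leQP'] := (local_pair_above sQP sPH pP).1 aboveP.
split=> // S pairS lePS; have [_ sSH pS _ _] := pairS.
have sQS := subset_trans sQP lePS.1.
have leQS : bp_le (local_bpair Qf Qf) S := bp_le_trans sSH leQP' lePS.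
have aboveS : brauer_pair_above p (fQ : AQ) (local_bpair Qf Qf) S by split.
have defS := local_unlocal pS sQS sSH; rewrite -defS in aboveS lePS *.
have [_ pairS' _] := (@local_pair_above (unlocal S) sQS sSH pS).2 aboveS.
congr (local_bpair Qf _); apply: maxP.2 => //.
exact: ((local_bp_le (S := unlocal S) chp permA sQG pS sQP sSH).1 lePS).
Qed.

End DefectPairs.

Theorem theorem4p8 (k : fieldType) (p : nat) (gT : finGroupType)
    (G N : {group gT}) (A : galgebra k G) (iota : interior A N) (c : A)
    (Qf Pf : bpair A) :
  p \in [pchar k] -> (N <| G)%g -> (p %| #|N|)%N ->
  p_permutation A p ->
  primitive_in (gfix A N) c -> c \in gfix A G ->
  brauer_pair p c Qf -> defect_group p N c (bp_grp Qf) ->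
  maximal_brauer_pair p c Pf -> bp_le Qf Pf ->
  primitive_in (gfix (brauer_quot A (bp_grp Qf)) 'C_N(bp_grp Qf)%g) (bp_blk Qf) ->
  let AQ := local_galg Qf in
  let fQ := bp_blk Qf : AQ in
  let Qf' := local_bpair Qf Qf in
  let Pf' := local_bpair Qf Pf in
  let C := full_subcategory (C := fusion_system p c Pf)
             (fun R => brauer_pair_above p c Qf (sval R)) in
  let D := full_subcategory (C := fusion_system p fQ Pf')
             (fun R => brauer_pair_above p fQ Qf' (sval R)) in
  maximal_brauer_pair p fQ Pf' /\ isomorphic_categories D C.
Proof.
move=> chp nNG _ permA _ _ pairQ defQ maxP leQP prim_fQ.
move=> AQ fQ Qf' Pf' C D; have [_ sQG _ _ _] := pairQ.
(* Maximality justifies calling the category over [Pf'] a fusion system of A(Q). *)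
split; first exact: (local_maximal chp nNG pairQ defQ maxP leQP prim_fQ).
apply: (fusion_transfer_iso
  (unlocal_transfer chp nNG pairQ defQ maxP leQP prim_fQ)
  (local_transfer chp nNG pairQ defQ maxP leQP prim_fQ)).
  move=> S /local_pair_above_sub[sQS sSH pS].
  exact: (local_unlocal chp pairQ pS sQS sSH).
move=> R /(pair_above_sub chp nNG pairQ defQ)[sQR sRH pR].
exact: (unlocal_local chp pairQ pR sQR sRH).
Qed.
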